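(* Let $(R,\mathfrak m)$ be a one-dimensional Cohen-Macaulay local ring with canonical module $K_R$, let $M$ be a maximal Cohen-Macaulay $R$-module and let $I$ be an ideal of $R$. Then the following statements are equivalent. (i) $R\ltimes M$ admits a canonical reduction of the form $I\times L$, for some submodule $L$ of $M$. (ii) $M\cong\operatorname{Hom}_R(I,K_R)$ and $I$ is a reduction of $\mathfrak m$.
   Context: $R\ltimes M$ is the idealization (Nagata extension) of $M$ over $R$: the additive group $R\oplus M$ with multiplication $(r,m)(r',m')=(rr',rm'+r'm)$; it is a local ring with maximal ideal $\mathfrak m\times M$, and is Cohen-Macaulay of dimension one here. All modules are finitely generated; maximal Cohen-Macaulay modules are nonzero. A canonical ideal of a Cohen-Macaulay local ring is an ideal isomorphic to a canonical module. An ideal $J\subseteq I$ is a reduction of $I$ if $I^{n+1}=JI^n$ for some $n$. A canonical reduction of a one-dimensional Cohen-Macaulay local ring is a canonical ideal that is a reduction of the maximal ideal. *)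

(* Defs.v *)
From HB Require Import structures.
From mathcomp Require Import all_boot all_order all_algebra.
From mathcomp Require Import generic_quotient ring_quotient.
From mathcomp Require Import boolp functions.

Set Implicit Arguments.
Unset Strict Implicit.
Unset Printing Implicit Defensive.

Import GRing.Theory.
Local Open Scope ring_scope.
Local Open Scope quotient_scope.

(* An ideal of R is a submodule of R^o.  Submodules are boolean predicates
   (submodClosed); by classical logic this is no restriction. *)
Notation ideal R := (submodClosed R^o).

Section Submodule.
Variables (R : comNzRingType) (V : lmodType R) (U : submodClosed V).

Record submod := Submod { submod_val : V; submod_valP : submod_val \in U }.

HB.instance Definition _ := [isSub for submod_val].
HB.instance Definition _ := [Choice of submod by <:].
HB.instance Definition _ := [SubChoice_isSubLmodule of submod by <:].

End Submodule.

Section QuotientModule.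
Variables (R : comNzRingType) (V : lmodType R) (U : submodClosed V).

(* submodClosed does not inherit from zmodClosed, which quot expects. *)
Definition quotmod_pred : {pred V} := fun x => x \in U.

Fact quotmod_pred_zmod : zmod_closed quotmod_pred.
Proof. exact: (GRing.submod_closedB (submodClosedP U)). Qed.

HB.instance Definition _ :=
  GRing.isZmodClosed.Build V quotmod_pred quotmod_pred_zmod.

Definition quotmod := Quotient.quot quotmod_pred.

HB.instance Definition _ := GRing.Zmodule.on quotmod.
HB.instance Definition _ := EqQuotient.on quotmod.

Definition quotmod_pi (x : V) : quotmod := \pi_quotmod x.

Definition quotmod_scale (a : R) (x : quotmod) : quotmod :=
  quotmod_pi (a *: repr x).

Lemma quotmod_piK x : quotmod_pi (repr x) = x.
Proof. exact: reprK. Qed.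

Lemma quotmod_eq x y : (quotmod_pi x = quotmod_pi y) <-> (x - y \in U).
Proof.
have -> : (x - y \in U) = (x == y %[mod quotmod]).
  by rewrite -[LHS]/(x - y \in quotmod_pred) Quotient.idealrBE.
by split=> [|/eqP //]; rewrite /quotmod_pi => ->.
Qed.

Lemma quotmod_piD x y : quotmod_pi x + quotmod_pi y = quotmod_pi (x + y).
Proof. by rewrite /quotmod_pi -(raddfD (\pi_(Quotient.quot quotmod_pred))). Qed.

Lemma quotmod_piZ a x : quotmod_scale a (quotmod_pi x) = quotmod_pi (a *: x).
Proof.
apply/quotmod_eq; rewrite -scalerBr; apply: rpredZ.
by apply/quotmod_eq; rewrite quotmod_piK.
Qed.

Fact quotmod_scaleA a b x :
  quotmod_scale a (quotmod_scale b x) = quotmod_scale (a * b) x.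
Proof. by rewrite -[x]quotmod_piK !quotmod_piZ scalerA. Qed.

Fact quotmod_scale1 : left_id 1 quotmod_scale.
Proof. by move=> x; rewrite -[x]quotmod_piK quotmod_piZ scale1r. Qed.

Fact quotmod_scaleDr : right_distributive quotmod_scale +%R.
Proof.
move=> a x y; rewrite -[x]quotmod_piK -[y]quotmod_piK.
by rewrite quotmod_piD !quotmod_piZ quotmod_piD scalerDr.
Qed.

Fact quotmod_scaleDl x : {morph quotmod_scale^~ x : a b / a + b}.
Proof.
by move=> a b; rewrite -[x]quotmod_piK !quotmod_piZ quotmod_piD scalerDl.
Qed.

HB.instance Definition _ := GRing.Zmodule_isLmodule.Build R quotmod
  quotmod_scaleA quotmod_scale1 quotmod_scaleDr quotmod_scaleDl.

End QuotientModule.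

Definition lmod_iso (R : comNzRingType) (U V : lmodType R) : Prop :=
  exists f : {linear U -> V}, bijective f.

(* Hom_R(U, V) is realised as a submodule of the module of all functions. *)
Section HomModule.
Variables (R : comNzRingType) (U V : lmodType R).

Definition linear_pred : {pred U -> V} := fun f => `[< linear f >].

Fact linear_pred_submod : subsemimod_closed linear_pred.
Proof.
split; first split.
- by apply/asboolP=> a x y; rewrite scaler0 addr0.
- move=> f g /asboolP lf /asboolP lg; apply/asboolP=> a x y.
  rewrite -[LHS]/(f (a *: x + y) + g (a *: x + y)) lf lg.
  by rewrite -[(f + g) x]/(f x + g x) -[(f + g) y]/(f y + g y) scalerDr addrACA.
- move=> b f /asboolP lf; apply/asboolP=> a x y.
  rewrite -[LHS]/(b *: f (a *: x + y)) lf.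
  rewrite -[(b *: f) x]/(b *: f x) -[(b *: f) y]/(b *: f y).
  by rewrite scalerDr !scalerA mulrC.
Qed.

HB.instance Definition _ :=
  GRing.isSubmodClosed.Build R (U -> V) linear_pred linear_pred_submod.

Definition HomMod := submod linear_pred.
HB.instance Definition _ := GRing.Lmodule.on HomMod.

Definition hom_fun (f : HomMod) : U -> V := submod_val f.

End HomModule.

Section Finiteness.
Variable R : comNzRingType.

Definition fin_gen (V : lmodType R) : Prop :=
  exists n (v : 'I_n -> V), forall x, exists c : 'I_n -> R,
    x = \sum_i c i *: v i.

Definition noetherian : Prop := forall I : ideal R, fin_gen (submod I).

Definition maximal_ideal (m : ideal R) : Prop :=
  1 \notin m /\
  forall J : ideal R, {subset m <= J} -> 1 \notin J -> J =i m.

Definition local_ring (m : ideal R) : Prop :=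
  maximal_ideal m /\ forall n : ideal R, maximal_ideal n -> n =i m.

Definition prime_chain (n : nat) : Prop :=
  exists p : nat -> prime_idealr R, forall i, (i < n)%N ->
    {subset p i <= p i.+1} /\ exists2 x, x \in p i.+1 & x \notin p i.

Definition krull_dim (n : nat) : Prop := prime_chain n /\ ~ prime_chain n.+1.

End Finiteness.

Section Depth.
Variables (R : comNzRingType) (m : ideal R) (V : lmodType R).

(* y belongs to (xs) V. *)
Definition in_seq_mul (xs : seq R) (y : V) : Prop :=
  exists v : nat -> V, y = \sum_(i < size xs) xs`_i *: v i.

Definition regular_seq (xs : seq R) : Prop :=
  (forall i, (i < size xs)%N -> forall y : V,
     in_seq_mul (take i xs) (xs`_i *: y) -> in_seq_mul (take i xs) y) /\
  exists y : V, ~ in_seq_mul xs y.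

Definition depth (d : nat) : Prop :=
  (exists xs, [/\ {subset xs <= m}, regular_seq xs & size xs = d]) /\
  forall xs, {subset xs <= m} -> regular_seq xs -> (size xs <= d)%N.

Definition maximal_CM : Prop :=
  fin_gen V /\ exists2 d, krull_dim R d & depth d.

End Depth.

Definition CM_local_ring (R : comNzRingType) (m : ideal R) : Prop :=
  [/\ noetherian R, local_ring m & exists2 d, krull_dim R d & depth m R^o d].

Definition injective_module (R : comNzRingType) (E : lmodType R) : Prop :=
  forall (A B : lmodType R) (i : {linear A -> B}) (f : {linear A -> E}),
    injective i -> exists g : {linear B -> E}, forall a, g (i a) = f a.

Record inj_resolution (R : comNzRingType) (C : lmodType R) := InjResolution {
  res_mod :> nat -> lmodType R;
  res_aug : {linear C -> res_mod 0};
  res_d : forall i, {linear res_mod i -> res_mod i.+1};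
  res_inj : forall i, injective_module (res_mod i);
  res_aug_inj : injective res_aug;
  res_exact0 : forall x, res_d 0 x = 0 <-> exists c, res_aug c = x;
  res_exactS : forall i x, res_d i.+1 x = 0 <-> exists y, res_d i y = x
}.

(* Ext^i_R(N, C), as the cohomology of Hom_R(N, E) for an injective
   resolution E of C. *)
Section Ext.
Variables (R : comNzRingType) (C : lmodType R) (E : inj_resolution C).
Variables (N : lmodType R).

Definition cocycle i : {pred HomMod N (E i)} :=
  fun f => `[< forall x, res_d E i (hom_fun f x) = 0 >].

Definition coboundary i : HomMod N (E i) -> Prop :=
  match i with
  | 0 => fun f => forall x, hom_fun f x = 0
  | j.+1 => fun f =>
      exists g : HomMod N (E j), forall x, hom_fun f x = res_d E j (hom_fun g x)
  end.

Fact cocycle_submod i : subsemimod_closed (@cocycle i).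
Proof.
split; first split.
- by apply/asboolP=> x; rewrite /hom_fun /= raddf0.
- move=> f g /asboolP hf /asboolP hg; apply/asboolP=> x.
  by rewrite -[hom_fun _ x]/(hom_fun f x + hom_fun g x) raddfD /= hf hg addr0.
- move=> a f /asboolP hf; apply/asboolP=> x.
  by rewrite -[hom_fun _ x]/(a *: hom_fun f x) linearZ /= hf scaler0.
Qed.

HB.instance Definition _ i :=
  GRing.isSubmodClosed.Build R (HomMod N (E i)) (@cocycle i) (@cocycle_submod i).

Definition coboundary_pred i : {pred submod (@cocycle i)} :=
  fun z => `[< coboundary (submod_val z) >].

Fact coboundary_submod i : subsemimod_closed (@coboundary_pred i).
Proof.
split; first split.
- apply/asboolP; case: i => [|i] //=.
  by exists 0 => x; rewrite /hom_fun /= raddf0.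
- move=> f g /asboolP + /asboolP +; case: i f g => [|i] f g /=.
    move=> hf hg; apply/asboolP=> x.
    by rewrite -[LHS]/(hom_fun (submod_val f) x + hom_fun (submod_val g) x) hf hg addr0.
  move=> [f' hf] [g' hg]; apply/asboolP; exists (f' + g') => x.
  rewrite -[LHS]/(hom_fun (submod_val f) x + hom_fun (submod_val g) x) hf hg.
  by rewrite -[hom_fun (_ + _) x]/(hom_fun f' x + hom_fun g' x) raddfD.
- move=> a f /asboolP; case: i f => [|i] f /=.
    move=> hf; apply/asboolP=> x.
    by rewrite -[LHS]/(a *: hom_fun (submod_val f) x) hf scaler0.
  move=> [f' hf]; apply/asboolP; exists (a *: f') => x.
  rewrite -[LHS]/(a *: hom_fun (submod_val f) x) hf.
  by rewrite -[hom_fun (_ *: _) x]/(a *: hom_fun f' x) linearZ.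
Qed.

HB.instance Definition _ i := GRing.isSubmodClosed.Build R
  (submod (@cocycle i)) (@coboundary_pred i) (@coboundary_submod i).

Definition Ext i := quotmod (@coboundary_pred i).
HB.instance Definition _ i := GRing.Lmodule.on (Ext i).

End Ext.

Section Canonical.
Variables (R : comNzRingType) (m : ideal R).

Definition finite_inj_dim (C : lmodType R) : Prop :=
  exists (E : inj_resolution C) (n : nat), forall i, (n < i)%N ->
    forall x : E i, x = 0.

(* r = dim_k Ext^t_R(k, C), with k = R/m and t = depth C.  Ext^t_R(k, C) is
   killed by m, so having dimension r over k means being R-isomorphic to k^r. *)
Definition CM_type (C : lmodType R) (r : nat) : Prop :=
  exists (t : nat) (E : inj_resolution C),
    depth m C t /\ lmod_iso (Ext E (quotmod m) t) {ffun 'I_r -> quotmod m}.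

(* Bruns and Herzog, Cohen-Macaulay Rings, Definition 3.3.1. *)
Definition canonical_module (C : lmodType R) : Prop :=
  [/\ maximal_CM m C, CM_type C 1 & finite_inj_dim C].

Definition canonical_ideal (J : ideal R) : Prop :=
  exists K : lmodType R, canonical_module K /\ lmod_iso (submod J) K.

End Canonical.

Section Reduction.
Variable R : comNzRingType.

Definition ideal_mul (I J : {pred R}) : {pred R} := fun x =>
  `[< exists s : seq (R * R),
        {in s, forall p, p.1 \in I /\ p.2 \in J} /\
        x = \sum_(p <- s) p.1 * p.2 >].

Definition ideal_exp (I : {pred R}) (n : nat) : {pred R} :=
  iter n (ideal_mul I) predT.

Definition reduction (J I : ideal R) : Prop :=
  {subset J <= I} /\
  exists n, ideal_exp I n.+1 =i ideal_mul J (ideal_exp I n).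

(* m is the maximal ideal of the local ring R. *)
Definition canonical_reduction (J : ideal R) : Prop :=
  exists m : ideal R,
    [/\ local_ring m, canonical_ideal m J & reduction J m].

End Reduction.

Section Idealization.
Variables (R : comNzRingType) (M : lmodType R).

Definition idealization : Type := (R * M)%type.

HB.instance Definition _ := GRing.Zmodule.on idealization.

Definition idealization_one : idealization := (1, 0).
Definition idealization_mul (x y : idealization) : idealization :=
  (x.1 * y.1, x.1 *: y.2 + y.1 *: x.2).

Fact idealization_mulA : associative idealization_mul.
Proof.
move=> [a x] [b y] [c z]; rewrite /idealization_mul /= mulrA; congr pair.
by rewrite !scalerDr !scalerA -addrA [c * a]mulrC [c * b]mulrC.
Qed.

Fact idealization_mulC : commutative idealization_mul.
Proof. by move=> [a x] [b y]; rewrite /idealization_mul /= mulrC addrC. Qed.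

Fact idealization_mul1 : left_id idealization_one idealization_mul.
Proof.
by move=> [a x]; rewrite /idealization_mul /= mul1r scale1r scaler0 addr0.
Qed.

Fact idealization_mulDl : left_distributive idealization_mul +%R.
Proof.
move=> [a x] [b y] [c z]; rewrite /idealization_mul /=.
apply/eqP; rewrite -pair_eqE /=; apply/andP; split; apply/eqP=> /=.
  exact: mulrDl.
by rewrite scalerDl scalerDr addrACA.
Qed.

Fact idealization_one_neq0 : idealization_one != 0.
Proof. by rewrite -pair_eqE /= oner_eq0. Qed.

HB.instance Definition _ := GRing.Zmodule_isComNzRing.Build idealization
  idealization_mulA idealization_mulC idealization_mul1 idealization_mulDl
  idealization_one_neq0.

End Idealization.

(* Main.v *)
(* In dimension one a finitely generated module C with a regular element x is
   canonical exactly when C/xC is an injective hull of the residue field over the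
   Artinian ring R/x. This form of the definition gives, by lifting along C -> C/xC
   and Nakayama's lemma, that canonical modules are unique, that they have no
   higher extensions by maximal Cohen-Macaulay modules, and that such modules are
   reflexive with respect to them.
   The canonical module of A = R x M is Hom_R(A, K) = K + Hom_R(M, K). If M is the
   dual of I, then Hom_R(M, K) = I, and multiplication K -> Hom_R(I, K) = M embeds K
   in M with image L, so that I x L is isomorphic to Hom_R(A, K). Conversely, an
   isomorphism from I x L to Hom_R(A, K), composed with the projection to
   Hom_R(M, K), is onto when restricted to I, and its kernel there is a direct
   complement of L in K; as K is indecomposable and IM is a nonzero part of L, this
   kernel is 0, so I is the dual of M and M the dual of I. *)
Require Import Defs.
From mathcomp Require Import all_boot all_algebra.
From HB Require Import structures.
From mathcomp Require Import boolp functions ring_quotient.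
From mathcomp Require Import ring.

Set Implicit Arguments.
Unset Strict Implicit.
Unset Printing Implicit Defensive.

Import GRing.Theory.
Local Open Scope ring_scope.

(** A single element [x] of [m], regular on R, serves all modules at once: [regular_of_depth1] makes
    it regular on K and M, and its image in A plays the same part there. No lengths and no Artinian
    rings appear. That a prime containing [x] contains [m] yields socle elements modulo submodules
    ([socle_elt]), and Noetherian induction on ideals, adjoining one socle element at a time, does
    the rest. The definition of a canonical module speaks of Ext and of finite injective dimension,
    so it has to be crossed in both directions. Downwards, the [x]-torsion of the cycles of a finite
    injective resolution is shown to be injective over R/x by descending degree, until C/xC is
    reached. Upwards, Hom_R(A, K) must satisfy the definition over A, which calls for a finite
    injective resolution over A: Hom_R(A, -) is applied to one of K, and exactness is the vanishing
    of Ext^i_R(M, K) for positive i. *)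

Section LmodTactic.
Variables (R : comNzRingType) (V : lmodType R).
Definition idl_vec (v : V) : idealization V := (0, v).
Definition idl_scal (r : R) : idealization V := (r, 0).

Lemma idl_vec_inj : injective idl_vec. Proof. by move=> u v []. Qed.

Lemma idl_vecD u v : idl_vec (u + v) = idl_vec u + idl_vec v.
Proof. by rewrite -[RHS]/(0 + 0, u + v) addr0. Qed.

Lemma idl_vecN u : idl_vec (- u) = - idl_vec u.
Proof. by rewrite -[RHS]/(- 0, - u) oppr0. Qed.

Lemma idl_vecZ r u : idl_vec (r *: u) = idl_scal r * idl_vec u.
Proof. by rewrite -[RHS]/(r * 0, r *: u + 0 *: 0) scaler0 addr0 mulr0. Qed.

Lemma idl_scalD r s : idl_scal (r + s) = idl_scal r + idl_scal s.
Proof. by rewrite -[RHS]/(r + s, 0 + 0) addr0. Qed.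

Lemma idl_scalN r : idl_scal (- r) = - idl_scal r.
Proof. by rewrite -[RHS]/(- r, - 0) oppr0. Qed.

Lemma idl_scalM r s : idl_scal (r * s) = idl_scal r * idl_scal s.
Proof. by rewrite -[RHS]/(r * s, r *: 0 + s *: 0) !scaler0 addr0. Qed.

Definition idlE := (idl_vecD, idl_vecN, idl_vecZ, erefl : idl_vec 0 = 0,
  idl_scalD, idl_scalN, idl_scalM, erefl : idl_scal 0 = 0,
  erefl : idl_scal 1 = 1).
End LmodTactic.

(* Identities in V become commutative ring identities in its idealization. *)
Ltac lmod := apply: idl_vec_inj; rewrite ?idlE; ring.

(** * Submodules as predicates, and finite generation *)

Definition is_sub (R : comNzRingType) (V : lmodType R) (U : V -> Prop) : Prop :=
  U 0 /\ forall r u v, U u -> U v -> U (r *: u + v).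

Lemma sub_closed (R : comNzRingType) (V : lmodType R) (U : V -> Prop) :
  is_sub U -> exists S : submodClosed V, forall v, (v \in S) <-> U v.
Proof.
move=> [U0 US].
pose P : {pred V} := fun v => `[< U v >].
have PS : subsemimod_closed P.
  split; first split.
  - exact/asboolP.
  - move=> u v /asboolP Uu /asboolP Uv; apply/asboolP.
    by rewrite -[u]scale1r; apply: US.
  - move=> a v /asboolP Uv; apply/asboolP.
    by rewrite -[_ *: _]addr0; apply: US.
pose b := GRing.isSubmodClosed.Build R V P PS.
pose S : submodClosed V := HB.pack P b.
by exists S => v; split=> /asboolP.
Qed.

Lemma mk_linear (R : comNzRingType) (U V : lmodType R) (f : U -> V) :
  linear f -> exists g : {linear U -> V}, g =1 f.
Proof.
move=> lf.
pose b := GRing.isLinear.Build R U V *:%R f lf.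
pose g : {linear U -> V} := HB.pack f b.
by exists g.
Qed.

Lemma linear_comb (R : comNzRingType) (U V : lmodType R) (f : {linear U -> V})
  r u v : f (r *: u + v) = r *: f u + f v.
Proof. by rewrite linearD linearZ_LR. Qed.

Lemma sub_prime (R : comNzRingType) (p : R -> Prop) : is_sub (p : R^o -> Prop) ->
  ~ p 1 -> (forall a b, p (a * b) -> p a \/ p b) ->
  exists q : prime_idealr R, forall a, (a \in q) <-> p a.
Proof.
move=> [p0 pS] p1 pM.
pose P : {pred R} := fun v => `[< p v >].
have h1 : idealr_closed P.
  split; [exact/asboolP|exact/asboolP|].
  by move=> a u v /asboolP pu /asboolP pv; apply/asboolP; apply: pS.
have h2 : prime_idealr_closed P.
  by move=> a b /asboolP /pM [] h; apply/orP; [left|right]; apply/asboolP.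
pose b1 := isIdealr.Build R P h1.
pose b2 := isPrimeIdealrClosed.Build R P h2.
pose q : prime_idealr R := HB.pack P b1 b2.
by exists q => v; split=> /asboolP.
Qed.

Section Submodules.
Variables (R : comNzRingType) (V : lmodType R).
Implicit Types (U W : V -> Prop) (s : seq V).

Lemma is_subD U u v : is_sub U -> U u -> U v -> U (u + v).
Proof. by move=> [_ US] Uu Uv; rewrite -[u]scale1r; apply: US. Qed.

Lemma is_subZ U r u : is_sub U -> U u -> U (r *: u).
Proof. by move=> [U0 US] Uu; rewrite -[_ *: _]addr0; apply: US. Qed.

Lemma is_subN U u : is_sub U -> U u -> U (- u).
Proof. by move=> hU Uu; rewrite -scaleN1r; apply: is_subZ. Qed.

Lemma is_subB U u v : is_sub U -> U u -> U v -> U (u - v).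
Proof. by move=> hU Uu Uv; apply: is_subD => //; apply: is_subN. Qed.

Lemma is_subBr U u v : is_sub U -> U u -> U (u - v) -> U v.
Proof. by move=> hU Uu Uuv; have := is_subB hU Uu Uuv; rewrite subKr. Qed.

Lemma is_subBl U u v : is_sub U -> U v -> U (u - v) -> U u.
Proof. by move=> hU Uv Uuv; rewrite -(subrK v u); apply: is_subD. Qed.

Lemma is_sub_trans U u v w : is_sub U -> U (u - v) -> U (v - w) -> U (u - w).
Proof. by move=> hU h1 h2; rewrite -(subrKA v); apply: is_subD. Qed.

Lemma is_sub_zero : is_sub (fun v : V => v = 0).
Proof. by split=> // r u v -> ->; rewrite scaler0 addr0. Qed.

Lemma is_sub_full : is_sub (fun v : V => True).
Proof. by []. Qed.

Lemma is_sub_cap U W : is_sub U -> is_sub W -> is_sub (fun v => U v /\ W v).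
Proof.
by move=> [U0 US] [W0 WS]; split=> // r u v [? ?] [? ?]; split; auto.
Qed.

Lemma is_sub_closed (S : submodClosed V) : is_sub (fun v => v \in S).
Proof.
by split=> [|r u v hu hv]; [apply: rpred0 | apply: rpredD => //; apply: rpredZ].
Qed.

Definition sum_sub U W : V -> Prop := fun v => exists2 u, U u & W (v - u).

Lemma is_sub_sum U W : is_sub U -> is_sub W -> is_sub (sum_sub U W).
Proof.
move=> [U0 US] [W0 WS]; split; first by exists 0 => //; rewrite subr0.
move=> r u v [u1 h1 h2] [v1 h3 h4]; exists (r *: u1 + v1); first exact: US.
by rewrite opprD addrACA -scalerBr; apply: WS.
Qed.

Lemma sum_subl U W u : is_sub W -> U u -> sum_sub U W u.
Proof. by move=> [W0 _] Uu; exists u; rewrite ?subrr. Qed.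

Lemma sum_subr U W u : is_sub U -> W u -> sum_sub U W u.
Proof. by move=> [U0 _] Wu; exists 0; rewrite ?subr0. Qed.

Definition line (y : V) : V -> Prop := fun v => exists r, v = r *: y.

Lemma is_sub_line y : is_sub (line y).
Proof.
split; first by exists 0; rewrite scale0r.
by move=> r _ _ [a ->] [b ->]; exists (r * a + b); rewrite scalerDl scalerA.
Qed.

Definition mulx (x : R) : V -> Prop := fun v => exists k, v = x *: k.

Lemma is_sub_mulx x : is_sub (mulx x).
Proof.
split; first by exists 0; rewrite scaler0.
move=> r _ _ [a ->] [b ->]; exists (r *: a + b).
by rewrite scalerDr !scalerA mulrC.
Qed.

Fixpoint spanned s (v : V) : Prop :=
  if s is y :: s' then exists r w, spanned s' w /\ v = r *: y + w else v = 0.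

Lemma is_sub_span s : is_sub (spanned s).
Proof.
elim: s => [|y s [h0 hS]] /=; first exact: is_sub_zero.
split; first by exists 0, 0; rewrite scale0r addr0.
move=> r _ _ [a [w [hw ->]]] [b [w' [hw' ->]]].
exists (r * a + b), (r *: w + w'); split; first exact: hS.
by rewrite scalerDr scalerA scalerDl addrACA.
Qed.

Lemma span_cat s t v :
  spanned (s ++ t) v <-> exists u, spanned s u /\ spanned t (v - u).
Proof.
elim: s v => [|y s IH] v /=.
  by split=> [h|[u [-> ]]]; [exists 0|]; rewrite subr0.
split.
  move=> [r [w [/IH [u [hu hw]] ->]]]; exists (r *: y + u); split.
    by exists r, u.
  by rewrite opprD addrACA subrr add0r.
move=> [_ [[r [w [hw ->]]] h]]; exists r, (v - r *: y); split.
  by apply/IH; exists w; split=> //; rewrite -addrA -opprD.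
by rewrite addrC subrK.
Qed.

Lemma span_sub s U : is_sub U -> (forall v, v \in s -> U v) ->
  forall v, spanned s v -> U v.
Proof.
move=> hU; elim: s => [|y s IH] hs v /=; first by move=> ->; case: hU.
move=> [r [w [hw ->]]]; case: (hU) => _; apply; first by apply: hs; rewrite inE eqxx.
by apply: IH => // u hu; apply: hs; rewrite inE hu orbT.
Qed.

Lemma span_mem s v : v \in s -> spanned s v.
Proof.
elim: s => //= y s IH; rewrite inE => /orP [/eqP -> | /IH hv].
  by exists 1, 0; rewrite scale1r addr0; split=> //; case: (is_sub_span s).
by exists 0, v; rewrite scale0r add0r.
Qed.

Definition fg U : Prop := exists s, forall v, U v <-> spanned s v.

Lemma fg_seq U : is_sub U -> fg U ->
  exists s : seq V, (forall v, v \in s -> U v) /\ forall v, U v -> spanned s v.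
Proof.
move=> hU [s hs]; exists s; split=> v; last by move/hs.
by move=> hv; apply/hs; apply: span_mem.
Qed.

Lemma span_sum s v : spanned s v -> exists c : nat -> R,
  v = \sum_(i < size s) c i *: s`_i.
Proof.
elim: s v => [|y s IH] v /=; first by move=> ->; exists (fun=> 0); rewrite big_ord0.
move=> [r [w [/IH [c ->] ->]]]; exists (fun i => if i is i'.+1 then c i' else r).
by rewrite big_ord_recl.
Qed.

Lemma fin_genP : fin_gen V <-> exists s, forall v, spanned s v.
Proof.
split=> [[n [v hv]]|[s hs]].
  exists [seq v i | i : 'I_n] => x; have [c ->] := hv x.
  have hS := is_sub_span [seq v i | i : 'I_n].
  apply: (big_ind (spanned [seq v i | i : 'I_n])).
  - by case: hS.
  - by move=> a b; apply: is_subD.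
  - move=> i _; apply: is_subZ => //; apply: span_mem; apply/codomP; by exists i.
exists (size s), (fun i => s`_i) => x.
by have [c ->] := span_sum (hs x); exists (fun i => c i).
Qed.

End Submodules.
Arguments mulx {R V} x _.
Arguments is_sub_mulx {R V} x.

Lemma submod_val_linear (R : comNzRingType) (V : lmodType R) (S : submodClosed V) :
  linear (@submod_val R V S).
Proof. by []. Qed.

Lemma fg_submod (R : comNzRingType) (V : lmodType R) (S : submodClosed V) :
  fin_gen (submod S) <-> fg (fun v => v \in S).
Proof.
split.
  move=> /fin_genP [s hs]; exists (map val s) => v.
  have key t (u : submod S) : spanned t u -> spanned (map val t) (val u).
    elim: t u => [|y t IH] u /=; first by move=> ->.
    by move=> [r [w [hw ->]]]; exists r, (val w); split; [exact: IH|].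
  split=> [hv|]; first exact: (key s (Submod hv)).
  apply: (span_sub (is_sub_closed S)).
  by move=> u /mapP [w _ ->]; apply: submod_valP.
move=> [s hs]; apply/fin_genP.
have hsS v : v \in s -> v \in S by move=> hv; apply/hs; apply: span_mem.
have key t : (forall v, v \in t -> v \in S) -> exists t' : seq (submod S),
    forall u : submod S, spanned t (val u) -> spanned t' u.
  elim: t => [|y t IH] ht.
    by exists [::] => u /= hu; apply: val_inj.
  have [t' ht'] : exists t' : seq (submod S),
      forall u : submod S, spanned t (val u) -> spanned t' u.
    by apply: IH => v hv; apply: ht; rewrite inE hv orbT.
  have hy : y \in S by apply: ht; rewrite inE eqxx.
  exists (Submod hy :: t') => u /= [r [w [hw huw]]].
  have hw' : w \in S.
    have -> : w = submod_val u - r *: y by rewrite huw addrC addKr.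
    apply: (is_subB (is_sub_closed S)); first exact: submod_valP.
    exact: (is_subZ _ (is_sub_closed S)).
  by exists r, (Submod hw'); split; [exact: ht'|apply: val_inj].
have [t' ht'] := key s hsS; exists t' => u; apply: ht'; apply/hs.
exact: submod_valP.
Qed.

(** * Noetherian rings *)

Definition noeth (R : comNzRingType) : Prop :=
  forall a : R^o -> Prop, is_sub a -> fg a.

Lemma noetherian_noeth (R : comNzRingType) : noetherian R <-> noeth R.
Proof.
split=> [hR a /sub_closed [S hS]|hR S].
  have [s hs] := (fg_submod S).1 (hR S).
  by exists s => v; rewrite -hs; split=> /hS.
by apply/fg_submod; apply: hR; apply: is_sub_closed.
Qed.

Section Noetherian.
Variables (R : comNzRingType) (hR : noeth R).

(** The coefficients of [y] in elements of [U], taken modulo the span of [s], form an ideal. Lifts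
    to [U] of its generators, together with generators of the part of [U] inside the span of [s],
    generate [U]. *)
Lemma sub_span_fg (V : lmodType R) (s : seq V) (U : V -> Prop) :
  is_sub U -> (forall u, U u -> spanned s u) -> fg U.
Proof.
elim: s U => [|y s IH] U hU hUs.
  exists [::] => v /=; split; first exact: hUs.
  by move=> ->; case: hU.
pose a : R^o -> Prop := fun r => exists w, spanned s w /\ U (r *: y + w).
have hs := is_sub_span s.
have ha : is_sub a.
  split; first by exists 0; rewrite scale0r addr0; split; [case: hs|case: hU].
  move=> t r r' [w [hw1 hw2]] [w' [hw1' hw2']].
  exists (t *: w + w'); split; first by apply: hs.2.
  have -> : (t *: r + r') *: y + (t *: w + w') =
            t *: (r *: y + w) + (r' *: y + w').
    by rewrite scalerDr scalerA scalerDl addrACA.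
  exact: hU.2.
have [rs [hrs1 hrs2]] := fg_seq ha (hR ha).
have [ss hss] : fg (fun v => U v /\ spanned s v).
  by apply: IH; [apply: is_sub_cap|move=> u []].
have key (ts : seq R^o) : (forall r, r \in ts -> a r) -> exists us : seq V,
    (forall u, u \in us -> U u) /\
    (forall r, spanned ts r -> exists2 u, spanned us u & spanned s (u - r *: y)).
  elim: ts => [|t ts IHt] hts.
    exists [::]; split=> // r /= ->; exists 0 => //.
    by rewrite scale0r subr0; case: hs.
  have [us [hus1 hus2]] := IHt (fun r hr => hts r (@mem_behead _ (t :: ts) r hr)).
  have [w [hw1 hw2]] := hts t (mem_head _ _).
  exists (t *: y + w :: us); split.
    by move=> u; rewrite inE => /orP [/eqP -> // | /hus1].
  move=> r /= [c [r' [/hus2 [u hu1 hu2] ->]]].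
  exists (c *: (t *: y + w) + u); first by exists c, u.
  have -> : (c *: t + r') *: y = c *: (t *: y) + r' *: y.
    by rewrite scalerA scalerDl.
  rewrite scalerDr opprD addrACA (addrC _ (c *: w)) addrK.
  by apply: is_subD => //; apply: is_subZ.
have [us [hus1 hus2]] := key rs hrs1.
exists (us ++ ss) => v; rewrite span_cat; split.
  move=> Uv; have [r [w [hw hv]]] := hUs _ Uv.
  have ar : a r.
    exists w; split=> //; first by rewrite -hv.
  have [u hu1 hu2] := hus2 r (hrs2 r ar).
  exists u; split=> //; apply/hss; split.
    by apply: is_subB => //; apply: (span_sub hU hus1).
  have -> : v - u = w - (u - r *: y) by rewrite hv opprB addrCA addrA.
  exact: is_subB.
move=> [u [hu /hss [Uvu _]]]; apply: is_subBl Uvu => //.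
exact: (span_sub hU hus1).
Qed.

Lemma sub_fg (V : lmodType R) (U : V -> Prop) : fin_gen V -> is_sub U -> fg U.
Proof. by move=> /fin_genP [s hs] hU; apply: (@sub_span_fg _ s). Qed.

(** Each counterexample has a strictly larger one, and choice produces a strictly increasing
    sequence. Its union is finitely generated, so all generators already lie in one member. *)
Lemma noeth_ind (P : (R^o -> Prop) -> Prop) :
  (forall a, is_sub a ->
    (forall b, is_sub b -> (forall r, a r -> b r) -> (exists2 r, b r & ~ a r) ->
       P b) -> P a) ->
  forall a, is_sub a -> P a.
Proof.
move=> H a0 ha0; apply: contrapT => nP0.
pose T := {a : R^o -> Prop | is_sub a /\ ~ P a}.
have next (a : T) : exists b : T, (forall r, sval a r -> sval b r) /\
    exists2 r, sval b r & ~ sval a r.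
  case: a => a [ha nPa] /=; apply: contrapT => nb; apply: nPa;
    apply: H => // b hb ab nab.
  by apply: contrapT => nPb; apply: nb; exists (exist _ b (conj hb nPb)).
have [f hf] := choice next.
pose c n := sval (iter n f (exist _ a0 (conj ha0 nP0) : T)).
have hc n : is_sub (c n) by rewrite /c; case: (iter _ _ _) => ? [].
have mono n k r : c n r -> c (n + k)%N r.
  elim: k => [|k IH] h; first by rewrite addn0.
  by rewrite addnS; apply: (hf _).1; apply: IH.
have hU : is_sub (fun r => exists n, c n r).
  split; first by exists 0%N; case: (hc 0%N).
  move=> r u v [n hn] [k hk]; exists (n + k)%N; apply: (hc _).2.
    exact: mono.
  by rewrite addnC; apply: mono.
have [s [hs1 hs2]] := fg_seq hU (hR hU).
have [N hN] : exists N, forall r, r \in s -> c N r.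
  elim: s hs1 {hs2} => [|y s IH] hs; first by exists 0%N.
  have [N hN] := IH (fun r hr => hs r (@mem_behead _ (y :: s) r hr)).
  have [k hk] := hs y (mem_head _ _).
  exists (N + k)%N => r; rewrite inE => /orP [/eqP -> | /hN hr].
    by rewrite addnC; apply: mono.
  exact: mono.
have [r h1 h2] := (hf (iter N f (exist _ a0 (conj ha0 nP0) : T))).2.
apply: h2; apply: (span_sub (hc N) hN); apply: hs2; exists N.+1; exact: h1.
Qed.

Lemma noeth_max (F : (R^o -> Prop) -> Prop) (a : R^o -> Prop) :
  is_sub a -> F a ->
  exists b, [/\ is_sub b, F b, (forall r, a r -> b r) &
    forall c, is_sub c -> F c -> (forall r, b r -> c r) -> forall r, c r -> b r].
Proof.
move=> ha; apply: (noeth_ind (P := fun a => F a -> exists b, [/\ is_sub b, F b,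
  (forall r, a r -> b r) & forall c, is_sub c -> F c ->
  (forall r, b r -> c r) -> forall r, c r -> b r])) => // {ha}a ha IH Fa.
have [max|] := pselect (forall c, is_sub c -> F c ->
  (forall r, a r -> c r) -> forall r, c r -> a r); first by exists a.
move=> /existsNP [c] /not_implyP [hc] /not_implyP [Fc] /not_implyP [ac].
move=> /existsNP [r] /not_implyP [cr nar].
have [b [hb Fb cb bmax]] := IH c hc ac (ex_intro2 _ _ r cr nar) Fc.
by exists b; split=> // t /ac /cb.
Qed.

End Noetherian.

(** * Local rings and the parameter x *)

Section Local.
Variables (R : comNzRingType) (m : ideal R).

(** An ideal maximal among those that contain a given nonunit but not 1 is a maximal ideal, hence
    equal to [m]. *)
Lemma local_unit : noeth R -> local_ring m ->
  forall a, a \notin m -> exists b, b * a = 1.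
Proof.
move=> hR [_ hm] a ham; have [[b hb]|nb] := pselect (line (a : R^o) 1).
  by exists b.
have [c [hc c1 ac cmax]] := noeth_max hR (F :=
  fun c => ~ c 1) (is_sub_line (a : R^o)) nb.
have [S hS] := sub_closed hc.
have Smax : maximal_ideal S.
  split; first by apply/negP => /hS.
  move=> J SJ J1 r; apply/idP/idP; last exact: SJ.
  move=> Jr; apply/hS; apply: (cmax _ (is_sub_closed J)) => //; first exact/negP.
  by move=> t /hS /SJ.
by case/negP: ham; rewrite -(hm S Smax); apply/hS/ac; exists 1; rewrite scale1r.
Qed.

Lemma maximal1 : local_ring m -> 1 \notin m.
Proof. by case=> [[]]. Qed.

Lemma maximal_prime : (forall a, a \notin m -> exists b, b * a = 1) ->
  forall a b, a * b \in m -> a \in m \/ b \in m.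
Proof.
move=> hu a b ab; have [am|am] := boolP (a \in m); [by left|right].
by have [c ca] := hu a am; rewrite -[b]mul1r -ca -mulrA; apply: (rpredZ c).
Qed.

Lemma proper_sub_maximal (p : R^o -> Prop) :
  (forall a, a \notin m -> exists b, b * a = 1) -> is_sub p -> ~ p 1 ->
  forall a, p a -> a \in m.
Proof.
move=> hu hp p1 a pa; apply: contrapT => /negP /hu [b ba]; apply: p1.
by rewrite -ba; apply: (is_subZ b hp).
Qed.

(* All that is used of dimension one is the last clause: a prime containing x
   contains m. *)
Definition local_param (x : R) : Prop :=
  [/\ noeth R, 1 \notin m, forall a, a \notin m -> exists b, b * a = 1,
      x \in m /\ (forall y, x * y = 0 -> y = 0) &
      forall p : R^o -> Prop, is_sub p -> ~ p 1 ->
        (forall a b, p (a * b) -> p a \/ p b) -> p x -> forall a, a \in m -> p a].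

(* A prime containing x but not m would have a smaller prime below it, disjoint
   from the multiplicative set of the x^i s with s outside p. *)
Lemma local_paramP x : noeth R -> local_ring m -> ~ prime_chain R 2 ->
  x \in m -> (forall y, x * y = 0 -> y = 0) -> local_param x.
Proof.
move=> hR hm hdim xm xreg; have hu := local_unit hR hm; have m1 := maximal1 hm.
split=> // p hp p1 pM px a am; apply: contrapT => npa.
have xXreg i y : x ^+ i * y = 0 -> y = 0.
  by elim: i => [|i IH]; rewrite ?mul1r // exprS -mulrA => /xreg.
pose F (b : R^o -> Prop) := forall i s, ~ p s -> ~ b (x ^+ i * s).
have F0 : F (fun r => r = 0).
  by move=> i s ps /xXreg s0; apply: ps; rewrite s0; case: hp.
have [b [hb Fb _ bmax]] := noeth_max hR (is_sub_zero _) F0.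
have bM u v : b (u * v) -> b u \/ b v.
  move=> buv; apply: contrapT => /not_orP [nbu nbv].
  have key w : ~ b w -> exists i s r, ~ p s /\ b (x ^+ i * s - r * w).
    move=> nbw; apply: contrapT => nex; apply: nbw.
    apply: (bmax (sum_sub b (line (w : R^o)))).
    - exact: is_sub_sum hb (is_sub_line _).
    - move=> i s ps [c bc [r hr]]; apply: nex; exists i, s, r; split=> //.
      by have -> : x ^+ i * s - r * w = c by apply/eqP;
        rewrite subr_eq addrC -subr_eq; apply/eqP.
    - by move=> r br; apply: sum_subl br; apply: is_sub_line.
    - by apply: sum_subr => //; exists 1; rewrite scale1r.
  have [i [s [r [ps h1]]]] := key u nbu.
  have [j [t [r' [pt h2]]]] := key v nbv.
  apply: (Fb (i + j)%N (s * t)); first by case/pM.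
  (* The product of the two congruences x^i s = r u and x^j t = r' v modulo [b], written out; the
     last term lies in [b] because [u * v] does. *)
  have -> : x ^+ (i + j) * (s * t) =
      (x ^+ j * t) *: (x ^+ i * s - r * u : R^o) + ((r * u) *:
        (x ^+ j * t - r' * v : R^o)
       + (r * r') *: (u * v : R^o)).
    rewrite /GRing.scale /= !mulrBr exprD.
    have -> : r * u * (r' * v) = r * r' * (u * v) by rewrite mulrACA.
    rewrite subrK (mulrC (r * u)) subrK mulrACA.
    by rewrite mulrC.
  by apply: hb.2 => //; apply: hb.2 => //; apply: is_subZ.
have nb1 : ~ b 1 by have := Fb 0 1 p1; rewrite mul1r.
have [q0 hq0] := sub_prime hb nb1 bM.
have [q1 hq1] := sub_prime hp p1 pM.
have [q2 hq2] := sub_prime (is_sub_closed m) (negP m1) (maximal_prime hu).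
(* [q0] misses [x], [q1] contains [x] but misses [a], and [q2] is [m]: a chain with two strict
   steps. *)
apply: hdim; exists (fun i => if i is 0 then q0 else if i is 1 then q1 else q2).
case=> [|[|//]] _; split.
- move=> r /hq0 br; apply/hq1; apply: contrapT => /(Fb 0).
  by rewrite mul1r.
- exists x; first exact/hq1.
  by apply/negP => /hq0 bx; apply: (Fb 1 1) => //; rewrite mulr1.
- by move=> r /hq1 pr; apply/hq2; apply: (proper_sub_maximal hu hp p1).
- by exists a; [apply/hq2|apply/negP => /hq1].
Qed.

End Local.

(** * Maps that are linear modulo a submodule, and their extension *)

Section LinMod.
Variables (R : comNzRingType) (V D : lmodType R).
Implicit Types (B : V -> Prop) (X : D -> Prop) (f : V -> D).

(* f induces a linear map B -> D/X; working with such f avoids quotients. *)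
Definition linmod B X f : Prop :=
  forall r u v, B u -> B v -> X (f (r *: u + v) - (r *: f u + f v)).

Lemma linmod0 B X f : is_sub B -> is_sub X -> linmod B X f -> X (f 0).
Proof.
move=> hB hX hf; have := hf 1 0 0 hB.1 hB.1.
by rewrite !scale1r addr0 opprD addrA subrr add0r => /(is_subN hX); rewrite opprK.
Qed.

Lemma linmodD B X f u v : linmod B X f -> B u -> B v ->
  X (f (u + v) - (f u + f v)).
Proof. by move=> hf Bu Bv; have := hf 1 u v Bu Bv; rewrite !scale1r. Qed.

Lemma linmodZ B X f r u : is_sub B -> is_sub X -> linmod B X f -> B u ->
  X (f (r *: u) - r *: f u).
Proof.
move=> hB hX hf Bu.
have := is_subD hX (hf r u 0 Bu hB.1) (linmod0 hB hX hf).
by rewrite addr0 opprD addrA subrK.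
Qed.

Lemma linmodB B X f u v : is_sub B -> is_sub X -> linmod B X f -> B u -> B v ->
  X (f (u - v) - (f u - f v)).
Proof.
move=> hB hX hf Bu Bv; have := hf (-1) v u Bv Bu.
by rewrite scaleN1r [- v + u]addrC scaleN1r [- f v + f u]addrC.
Qed.

Lemma linmod_congr B X f u v : is_sub B -> is_sub X -> linmod B X f ->
  B u -> B v -> X (f (u - v)) -> X (f u - f v).
Proof.
move=> hB hX hf Bu Bv h.
exact: (is_subBr hX h (linmodB hB hX hf Bu Bv)).
Qed.

Lemma linmod_eq B f : linmod B (fun d => d = 0) f ->
  forall r u v, B u -> B v -> f (r *: u + v) = r *: f u + f v.
Proof. by move=> hf r u v Bu Bv; apply/subr0_eq; apply: hf. Qed.

(** Sending [b + r *: y] to [f b + r *: z] is well defined modulo [X]: two such expressions of one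
    vector differ by a multiple of [y] that lies in [B], and there the hypothesis compares [f] with
    [z]. *)
Lemma extend_one B X f y z : is_sub B -> is_sub X -> linmod B X f ->
  (forall r, B (r *: y) -> X (f (r *: y) - r *: z)) ->
  exists g, [/\ linmod (sum_sub B (line y)) X g,
    forall b, B b -> X (g b - f b) & X (g y - z)].
Proof.
move=> hB hX hf hz.
have dec v : exists p : V * R, sum_sub B (line y) v -> B p.1 /\ v = p.1 + p.2 *: y.
  have [[b Bb [r hr]]|nv] := pselect (sum_sub B (line y) v).
    by exists (b, r); split=> //=; rewrite -hr addrC subrK.
  by exists (0, 0) => /nv.
have [p hp] := choice dec.
pose g v := f (p v).1 + (p v).2 *: z.
have key b r : B b -> X (g (b + r *: y) - (f b + r *: z)).
  move=> Bb; set v := b + r *: y.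
  have [Bp hv] : B (p v).1 /\ v = (p v).1 + (p v).2 *: y.
    by apply: hp; exists b => //; exists r; rewrite /v addrC addKr.
  have e : ((p v).2 - r) *: y = b - (p v).1.
    transitivity (v - (p v).1 - r *: y); first by rewrite {2}hv; lmod.
    by rewrite /v; lmod.
  have /hz : B (((p v).2 - r) *: y) by rewrite e; apply: is_subB.
  rewrite e => h1; have h2 := linmodB hB hX hf Bb Bp.
  have := is_subB hX h2 h1; rewrite /g.
  by congr X; lmod.
exists g; split.
- move=> r u v [b Bb [c hu]] [b' Bb' [c' hv]].
  have -> : u = b + c *: y by rewrite -hu addrC subrK.
  have -> : v = b' + c' *: y by rewrite -hv addrC subrK.
  have h1 := key _ (r * c + c') (hB.2 r _ _ Bb Bb').
  have h2 := hf r _ _ Bb Bb'.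
  have h3 := is_subZ r hX (key _ c Bb); have h4 := key _ c' Bb'.
  have := is_subB hX (is_subD hX h1 h2) (is_subD hX h3 h4).
  have -> : r *: (b + c *: y) + (b' + c' *: y) = r *: b + b' + (r * c + c') *: y.
    by lmod.
  by congr X; lmod.
- move=> b Bb; have := key b 0 Bb; rewrite scale0r addr0.
  by congr X; lmod.
- have := is_subD hX (key 0 1 hB.1) (linmod0 hB hX hf); rewrite scale1r add0r.
  by congr X; lmod.
Qed.

(* Baer's criterion for D/X over R/x; the ideals of R/x are those containing x. *)
Definition baer (x : R) X : Prop := forall a : R^o -> Prop, is_sub a -> a x ->
  forall f : R -> D, (forall r u v, a u -> a v ->
    X (f (r * u + v) - (r *: f u + f v))) -> X (f x) ->
  exists d, forall s, a s -> X (f s - s *: d).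

(** Generators are adjoined one at a time. For a generator [y], the ideal of all r with [r *: y] in
    [B] contains [x], since [B] contains every [x]-multiple; so [baer] provides the value at [y]. *)
Lemma extend_fg x X (s : seq V) B f : is_sub X -> baer x X -> is_sub B ->
  (forall v, B (x *: v)) -> linmod B X f -> (forall v, X (f (x *: v))) ->
  (forall v, sum_sub B (spanned s) v) ->
  exists g, linmod (fun=> True) X g /\ forall b, B b -> X (g b - f b).
Proof.
move=> hX hbaer; elim: s B f => [|y s IH] B f hB Bx hf fx Bs.
  exists f; split=> [r u v _ _|b _]; last by rewrite subrr; case: hX.
  by apply: hf; [have [b ? /subr0_eq ->] := Bs u|have [b ? /subr0_eq ->] := Bs v].
have [z hz] : exists z, forall r, B (r *: y) -> X (f (r *: y) - r *: z).
  apply: (hbaer (fun r => B (r *: y)) _ (Bx y) (fun r => f (r *: y))).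
  - split=> [|r u v hu hv]; first by rewrite scale0r; case: hB.
    by rewrite scalerDl -scalerA; apply: hB.2.
  - by move=> r u v hu hv; rewrite scalerDl -scalerA; apply: hf.
  - exact: fx.
have [g [hg gf _]] := extend_one hB hX hf hz.
have Bl v : B v -> sum_sub B (line y) v.
  by move=> Bv; apply: sum_subl Bv; apply: is_sub_line.
have [||||g' [hg' g'f]] := IH _ g _ _ hg.
- exact: is_sub_sum hB (is_sub_line y).
- by move=> v; apply: Bl.
- by move=> v; apply: (is_subBl hX (fx v) (gf _ (Bx v))).
- move=> v; have [b Bb [r [w [hw hv]]]] := Bs v.
  exists (b + r *: y); first by exists b => //; exists r; rewrite addrC addKr.
  by have -> : v - (b + r *: y) = w by rewrite opprD addrA hv addrC addKr.
exists g'; split=> // b Bb; exact: (is_sub_trans hX (g'f _ (Bl _ Bb)) (gf _ Bb)).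
Qed.

End LinMod.
Arguments linmod {R V D} B X f.

(** * Dimension and depth one *)

Section Depth.
Variable R : comNzRingType.

Lemma prime_chain_le d d' : (d' <= d)%N -> prime_chain R d -> prime_chain R d'.
Proof.
by move=> led [p hp]; exists p => i hi; apply: hp; apply: leq_trans hi led.
Qed.

Lemma krull_dim_unique d d' : krull_dim R d -> krull_dim R d' -> d = d'.
Proof.
move=> [h1 h2] [h3 h4]; apply/eqP; rewrite eqn_leq; apply/andP; split.
  by rewrite leqNgt; apply/negP => h; apply: h4; apply: prime_chain_le h h1.
by rewrite leqNgt; apply/negP => h; apply: h2; apply: prime_chain_le h h3.
Qed.

Lemma in_seq_mul_nil (V : lmodType R) (y : V) : in_seq_mul [::] y <-> y = 0.
Proof.
by split=> [[v ->]|->]; [|exists (fun=> 0)]; rewrite big_ord0.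
Qed.

Lemma in_seq_mul1 (V : lmodType R) x (y : V) : in_seq_mul [:: x] y <-> mulx x y.
Proof.
split=> [[v ->]|[k ->]]; last by exists (fun=> k); rewrite big_ord1.
by rewrite big_ord1; exists (v 0%N).
Qed.

Definition regular (V : lmodType R) (x : R) : Prop :=
  forall y : V, x *: y = 0 -> y = 0.

Lemma regular_seq1 (V : lmodType R) x :
  regular_seq V [:: x] <-> regular V x /\ exists y : V, ~ mulx x y.
Proof.
split=> [[h1 [y hy]]|[h1 [y hy]]].
  split; last by exists y => /in_seq_mul1.
  move=> z xz; apply/in_seq_mul_nil/(h1 0%N isT z).
  exact/in_seq_mul_nil.
split; last by exists y => /in_seq_mul1.
by case=> // _ z /in_seq_mul_nil xz; apply/in_seq_mul_nil; apply: h1.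
Qed.

Variable m : ideal R.

Lemma depth_unique (V : lmodType R) d d' : depth m V d -> depth m V d' -> d = d'.
Proof.
move=> [[s [h1 h2 <-]] h3] [[t [h4 h5 <-]] h6].
by apply/eqP; rewrite eqn_leq h6 // h3.
Qed.

Lemma depth1_regular (V : lmodType R) : depth m V 1 ->
  exists x, [/\ x \in m, regular V x & exists y : V, ~ mulx x y].
Proof.
move=> [[[|x [|? ?]] [h1 h2 // _]] _]; exists x.
have [h3 h4] := (regular_seq1 V x).1 h2.
by split=> //; apply: h1; apply: mem_head.
Qed.

Lemma maximal_CM_depth1 (V : lmodType R) : krull_dim R 1 -> maximal_CM m V ->
  depth m V 1.
Proof. by move=> h1 [_ [d h2 hd]]; rewrite (krull_dim_unique h1 h2). Qed.

End Depth.

(** * Socle elements and Nakayama's lemma *)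

Section Param.
Variables (R : comNzRingType) (m : ideal R) (x : R).
Hypothesis Hx : local_param m x.

Lemma param_noeth : noeth R. Proof. by case: Hx. Qed.
Lemma param_mem : x \in m. Proof. by case: Hx => _ _ _ [] ?. Qed.
Lemma param_reg y : x * y = 0 -> y = 0. Proof. by case: Hx => _ _ _ [] ? h _;
  apply: h. Qed.
Lemma param_unit a : a \notin m -> exists b, b * a = 1.
Proof. by case: Hx => _ _ h _ _; apply: h. Qed.
Lemma param1 : 1 \notin m. Proof. by case: Hx. Qed.

Lemma param_unit1 a : a \in m -> exists b, b * (1 - a) = 1.
Proof.
move=> am; apply: param_unit; apply/negP => h; case/negP: param1.
by rewrite -[1](subrK a); apply: rpredD.
Qed.

(** Among the multiples of [y] outside [B], one is taken whose annihilator modulo [B] is maximal. As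
    for associated primes, that annihilator is prime; it contains [x], hence [m]. *)
Lemma socle_elt (V : lmodType R) (B : V -> Prop) y : is_sub B -> ~ B y ->
  B (x *: y) -> exists r, ~ B (r *: y) /\ forall a, a \in m -> B (a *: (r *: y)).
Proof.
move=> hB nBy Bxy.
pose ann r : R^o -> Prop := fun t => B (t *: (r *: y)).
pose F c := exists r, ~ B (r *: y) /\ c = ann r.
have hann r : is_sub (ann r).
  split; rewrite /ann; first by rewrite scale0r; case: hB.
  by move=> t u v hu hv; rewrite scalerDl -scalerA; apply: hB.2.
have F1 : F (ann 1) by exists 1; rewrite scale1r.
have [_ [_ [r [nBr ->]] h1 hmax]] := noeth_max param_noeth (hann 1) F1.
exists r; split=> // a am; case: Hx => _ _ _ _ hprime.
apply: (hprime (ann r)) => //.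
- by rewrite /ann scale1r.
- move=> u v huv; have [hv|nv] := pselect (ann r v); [by right|left].
  apply: (hmax (ann (v * r))) => //.
  + by exists (v * r); split=> //; rewrite -scalerA.
  + move=> t ht; rewrite /ann;
      have -> : t *: ((v * r) *: y) = v *: (t *: (r *: y)) by lmod.
    exact: is_subZ.
  + by move: huv; rewrite /ann !scalerA mulrA.
- by apply: h1; rewrite /ann scale1r.
Qed.

(** A nonzero [x]-torsion element would have a nonzero multiple killed by [m], but some element of
    [m] is regular on [V]. *)
Lemma regular_of_depth1 (V : lmodType R) : depth m V 1 -> regular V x.
Proof.
move=> /depth1_regular [z [zm zreg _]] y xy; apply: contrapT => ny.
have [r [nr hr]] := socle_elt (is_sub_zero V) ny xy.
by apply/nr/zreg/hr.
Qed.

(** Each generator is redundant: from y = u + x k and k = u' + c y + w follows (1 - x c) y = u + x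
    u' + x w, and 1 - x c is a unit. The form with [W] inside [V] is what applies to kernels. *)
Lemma nakayama (V : lmodType R) (s : seq V) (U W : V -> Prop) :
  is_sub U -> is_sub W -> (forall v, U v -> W v) ->
  (forall v, v \in s -> W v) -> (forall v, W v -> sum_sub U (spanned s) v) ->
  (forall v, W v -> exists u k, [/\ U u, W k & v = u + x *: k]) ->
  forall v, W v -> U v.
Proof.
move=> hU hW UW; elim: s => [|y s IH] sW Ws Wx.
  by move=> v /Ws [u Uu /= /subr0_eq ->].
have hUs := is_sub_sum hU (is_sub_span s).
have [u [k [Uu Wk hy]]] := Wx y (sW y (mem_head _ _)).
have [u' Uu' [c [w [hw hk]]]] := Ws k Wk.
have [|b hb] := @param_unit1 (x * c).
  by rewrite mulrC; apply: (rpredZ c); exact: param_mem.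
have Usy : sum_sub U (spanned s) y.
  exists (b *: u + (b * x) *: u').
    by apply: hU.2 => //; apply: is_subZ.
  have -> : y - (b *: u + (b * x) *: u') = (b * x) *: w;
    last by apply: is_subZ (is_sub_span s) _.
  have -> : w = k - u' - c *: y by rewrite hk addrC addKr.
  rewrite -[X in X - _](scale1r y) -hb.
  suff -> : (b * (1 - x * c)) *: y = b *: (u + x *: k) - (b * (x * c)) *: y by lmod.
  by rewrite -hy; lmod.
apply: IH => // [v hv|v Wv]; first by apply: sW; rewrite inE hv orbT.
have [v' Uv' [r [t [ht hv]]]] := Ws v Wv.
have -> : v = v' + r *: y + t by rewrite -addrA -hv addrC subrK.
apply: is_subD => //; last by apply: sum_subr.
apply: is_subD => //; first by apply: sum_subl => //; apply: is_sub_span.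
exact: is_subZ.
Qed.

Lemma nakayama_full (V : lmodType R) (U : V -> Prop) : fin_gen V -> is_sub U ->
  (forall v, exists u k, U u /\ v = u + x *: k) -> forall v, U v.
Proof.
move=> /fin_genP [s hs] hU h v.
apply: (@nakayama _ s U (fun=> True)) => // [w _|w _].
  by exists 0; [case: hU|rewrite subr0].
by have [u [k [Uu ->]]] := h w; exists u, k.
Qed.

End Param.

(** * Injective modules *)

Section Injective.
Variables (R : comNzRingType) (E : lmodType R) (hE : injective_module E).

Lemma injective_extend (V : lmodType R) (U : V -> Prop) (f : V -> E) :
  is_sub U -> linmod U (fun e => e = 0) f ->
  exists g : {linear V -> E}, forall u, U u -> g u = f u.
Proof.
move=> hU hf; have [S hS] := sub_closed hU.
have hSU (u : submod S) : U (submod_val u) by apply/hS; apply: submod_valP.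
have [i hi] := mk_linear (@submod_val_linear _ _ S).
have [|f' hf'] := @mk_linear _ (submod S) E (f \o @submod_val _ _ S).
  by move=> r u v; apply: (linmod_eq hf r (hSU u) (hSU v)).
have [|g hg] := @hE _ _ i f'.
  by move=> u v; rewrite !hi; apply: val_inj.
exists g => u /hS hu; have := hg (Submod hu).
by rewrite hi hf'.
Qed.

Lemma injective_ideal (a : R^o -> Prop) (f : R -> E) : is_sub a ->
  (forall r u v, a u -> a v -> f (r * u + v) = r *: f u + f v) ->
  exists e, forall s, a s -> f s = s *: e.
Proof.
move=> ha hf; have [|g hg] := @injective_extend R^o a f ha.
  by move=> r u v au av; apply/eqP; rewrite subr_eq0; apply/eqP; apply: hf.
exists (g 1) => s /hg <-.
by rewrite -linearZ /GRing.scale /= mulr1.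
Qed.

(** The map r x -> r e on the ideal generated by [x] is well defined because [x] is regular, and
    injectivity makes it multiplication by an element of [E]. *)
Lemma injective_divisible x : (forall y, x * y = 0 -> y = 0) ->
  forall e : E, exists e', x *: e' = e.
Proof.
move=> xreg e.
have dec s : exists r, line (x : R^o) s -> s = r * x.
  have [[r hr]|n] := pselect (line (x : R^o) s); first by exists r.
  by exists 0.
have [q hq] := choice dec.
have uniq r s : r * x = s * x -> r = s.
  by move=> h; apply/subr0_eq/xreg; rewrite mulrC mulrBl h subrr.
have [r u v [u' hu] [v' hv]|e' he'] :=
  @injective_ideal (line (x : R^o)) (fun s => q s *: e) (is_sub_line _).
  rewrite scalerA -scalerDl; congr (_ *: _); apply: uniq.
  rewrite -hq; last by apply: (is_sub_line (x : R^o)).2; [exists u'|exists v'].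
  by rewrite mulrDl -mulrA -!hq //; [exists v'|exists u'].
exists e'; rewrite -he'; last by exists 1; rewrite scale1r.
have -> : q x = 1 by apply: uniq; rewrite -hq ?mul1r //; exists 1; rewrite scale1r.
by rewrite scale1r.
Qed.

End Injective.

(** * From finite injective dimension to injectivity modulo x *)

Section CanonicalProperties.
Variables (R : comNzRingType) (m : ideal R) (x : R).
Hypothesis Hx : local_param m x.

(** The residue field embeds in R/x. This is what forces a finite injective dimension over R/x down
    to zero. *)
Lemma param_socle : exists s : R^o, ~ mulx x s /\
  forall a, a \in m -> exists k, a * s = x * k.
Proof.
have n1 : ~ mulx x (1 : R^o).
  move=> [k hk]; case/negP: (param1 Hx); rewrite hk /GRing.scale /= mulrC.
  by apply: (rpredZ k); apply: param_mem Hx.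
have x1 : mulx x (x *: (1 : R^o)) by exists 1.
have [r [h1 h2]] := socle_elt Hx (is_sub_mulx x) n1 x1.
by exists (r *: 1); split=> // a /h2 [k hk]; exists k.
Qed.

Lemma unit_cancel (V : lmodType R) (U : V -> Prop) (r : R) (v : V) : is_sub U ->
  r \notin m -> U (r *: v) -> U v.
Proof.
move=> hU /(param_unit Hx) [b br] Urv.
by rewrite -[v]scale1r -br -scalerA; apply: is_subZ.
Qed.

Section Resolution.
Variables (C : lmodType R) (E : inj_resolution C).
Hypothesis Creg : regular C x.

Let Einj i : injective_module (E i) := @res_inj _ _ E i.

Lemma res_dd i (e : E i) : res_d E i.+1 (res_d E i e) = 0.
Proof. by apply/res_exactS; exists e. Qed.

Lemma res_d_aug c : res_d E 0 (res_aug E c) = 0.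
Proof. by apply/res_exact0; exists c. Qed.

Lemma res_divisible i (e : E i) : exists e', x *: e' = e.
Proof.
apply: injective_divisible => [|y]; first exact: @Einj.
exact: (param_reg Hx).
Qed.

(* The x-torsion of the i-th cycles is injective over R/x. *)
Definition cycle_baer i : Prop := forall (a : R^o -> Prop) (e : E i),
  is_sub a -> a x -> (forall s, a s -> res_d E i (s *: e) = 0) -> x *: e = 0 ->
  exists2 e', res_d E i e' = 0 & forall s, a s -> s *: e = s *: e'.

(* Lifting along E i.+1 -> E i.+2 an element killed by m: the residue field is
   the socle of R/x, so such an element is s w with w killed by x. *)
Lemma cycle_socle_lift i (v : E i.+1) : cycle_baer i.+2 ->
  (forall a, a \in m -> res_d E i.+1 (a *: v) = 0) ->
  exists2 z, res_d E i.+1 z = 0 & forall a, a \in m -> a *: v = a *: z.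
Proof.
move=> hbaer hv; set w := res_d E i.+1 v.
have mw a : a \in m -> a *: w = 0 by move=> /hv; rewrite linearZ_LR.
have [s0 [ns0 ms0]] := param_socle.
have hX := is_sub_mulx (V := R^o) x.
(* On the ideal generated by [x] and [s0], killing [x] and sending [s0] to [w] is well defined: if
   [r *: s0] is a multiple of [x], then r lies in [m] and kills [w]. *)
have [||g [hg g0 gs0]] :=
  @extend_one R R^o (E i.+2) (mulx x) (fun e =>
    e = 0) (fun=> 0) s0 w hX (is_sub_zero _).
- by move=> r u u' _ _; rewrite scaler0 addr0 subr0.
- move=> r hr; rewrite sub0r; apply/eqP; rewrite oppr_eq0; apply/eqP; apply: mw.
  by apply: contrapT => /negP rm; apply: ns0; apply: unit_cancel rm hr.
have [|e2 he2] := @injective_ideal R (E i.+2) (@Einj _) _ g (is_sub_sum hX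
  (is_sub_line s0)).
  exact: (linmod_eq hg).
have s0e2 : s0 *: e2 = w.
  rewrite -he2; first exact/subr0_eq.
  by apply: sum_subr => //; exists 1; rewrite scale1r.
have xe2 k : (x * k) *: e2 = 0.
  have xk : mulx (V := R^o) x (x * k) by exists k.
  rewrite -he2; last by apply: sum_subl xk; apply: is_sub_line.
  by have := g0 _ xk; rewrite subr0.
(* [e2] need not be a cycle, but its multiples by this ideal are multiples of [w], which is one; so
   [hbaer] replaces [e2] by a cycle [w1]. *)
have [||||w1 dw1 hw1] := hbaer (sum_sub (mulx x) (line s0)) e2.
- exact: is_sub_sum hX (is_sub_line s0).
- by apply: sum_subl; [apply: is_sub_line|exists 1; rewrite /GRing.scale /= mulr1].
- move=> s [b [k hb] [r hr]].
  have -> : s *: e2 = r *: w.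
    rewrite -[s](subrK b) hr hb scalerDl -scalerA [(x *: k) *: e2]xe2 addr0.
    by rewrite s0e2.
  by rewrite linearZ_LR /= res_dd scaler0.
- by rewrite -[x]mulr1 xe2.
have s0w1 : s0 *: w1 = w.
  by rewrite -hw1 //; apply: sum_subr => //; exists 1; rewrite scale1r.
have xw1 : x *: w1 = 0.
  rewrite -hw1; first by rewrite -[x]mulr1 xe2.
  by apply: sum_subl; [apply: is_sub_line|exists 1; rewrite /GRing.scale /= mulr1].
have [u hu] := (res_exactS _).1 dw1.
have [y hy] : exists y, res_d E i y = x *: u.
  by apply/res_exactS; rewrite linearZ_LR hu.
have [y' hy'] := res_divisible y.
(* [x] kills [w1] but perhaps not its preimage [u]. Since [x *: u] is a boundary and [E i] is
   divisible by [x], a boundary corrects [u]. *)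
pose u' := u - res_d E i y'.
have xu' : x *: u' = 0 by rewrite scalerBr -linearZ_LR hy' hy subrr.
have du' : res_d E i.+1 u' = w1 by rewrite linearB /= res_dd hu subr0.
(* As [m] multiplies [s0] into the ideal of [x], and [x] kills [u'], the correction [s0 *: u'] is
   killed by [m]. *)
exists (v - s0 *: u').
  by rewrite linearB linearZ_LR /= du' s0w1 subrr.
move=> a am; rewrite scalerBr scalerA; have [k ->] := ms0 a am.
by rewrite mulrC -scalerA xu' scaler0 subr0.
Qed.

(** Noetherian induction on the ideal [a]. If 1 is not in [a], a socle element [s] modulo [a] is
    adjoined, and [e] is replaced by an [e1] that acts alike on [a] and takes [s] to the cycle from
    [cycle_socle_lift]. *)
Lemma cycle_baer_step i : cycle_baer i.+2 -> cycle_baer i.+1.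
Proof.
move=> hbaer a e ha; move: a ha e.
apply: (noeth_ind (param_noeth Hx)) => a ha IH e ax ae xe.
have [a1|na1] := pselect (a 1).
  by exists e => //; have := ae 1 a1; rewrite scale1r.
have ax1 : a (x *: 1) by rewrite /GRing.scale /= mulr1.
have [r [nar mr]] := socle_elt Hx ha na1 ax1.
set s := r *: 1 in nar mr.
have [|z dz hz] := cycle_socle_lift (v := s *: e) hbaer.
  by move=> b bm; rewrite scalerA; apply: ae; apply: mr.
have [||g [hg ge gs]] :=
  @extend_one R R^o (E i.+1) a (fun e => e = 0) (fun t => t *:
    e) s z ha (is_sub_zero _).
- by move=> b u v _ _; rewrite scalerDl scalerA subrr.
- move=> b abs; have [bm|bm] := boolP (b \in m); last by case: nar;
    apply: unit_cancel bm abs.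
  by rewrite -hz // [X in _ - X]scalerA; apply: subrr.
have hs := is_sub_sum ha (is_sub_line s).
have as_ t : a t -> sum_sub a (line s) t by apply: sum_subl; apply: is_sub_line.
have [|e1 he1] := @injective_ideal R (E i.+1) (@Einj _) _ g hs.
  exact: (linmod_eq hg).
have aeq t : a t -> t *: e1 = t *: e.
  by move=> at_; rewrite -he1; [apply/subr0_eq/ge|apply: as_].
have seq_ : s *: e1 = z.
  rewrite -he1; first exact/subr0_eq.
  by apply: sum_subr => //; exists 1; rewrite scale1r.
have [|||||e' de' he'] := IH _ hs _ _ e1.
- exact: as_.
- by exists s => //; apply: sum_subr => //; exists 1; rewrite scale1r.
- exact: as_.
- move=> t [b ab [c hc]].
  rewrite -[t](subrK b) hc scalerDl -scalerA seq_ aeq // linearD linearZ_LR /= dz.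
  by rewrite scaler0 add0r ae.
- by rewrite aeq.
by exists e' => // t at_; rewrite -he' ?aeq //; apply: as_.
Qed.

(** The induction descends from degree n + 1, where [E] vanishes; once the truncated [n - k] reaches
    0 the claim no longer changes. *)
Lemma cycle_baer1 n : (forall i, (n < i)%N -> forall e : E i, e = 0) -> cycle_baer 1.
Proof.
move=> hn; have H k : cycle_baer (n - k).+1.
  elim: k => [|k IH].
    by move=> a e _ _ _ _; exists 0; rewrite ?linear0 // => s _;
      rewrite (hn _ _ e) // subn0.
  case nk : (n - k)%N IH => [|i] IH; first by rewrite subnS nk.
  by rewrite subnS nk /=; apply: cycle_baer_step.
by have := H n; rewrite subnn.
Qed.

(* The x-torsion of E 0 is injective over R/x and embeds in that of the first
   cycles, with cokernel C/xC. *)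
Lemma baer_of_cycle : cycle_baer 1 -> baer (D := C) x (mulx x).
Proof.
move=> hbaer a ha ax f hf fx.
have tors0 e : x *: e = 0 -> res_d E 0 e = 0 -> e = 0.
  move=> xe /res_exact0 [c hc]; rewrite -hc.
  have -> : c = 0.
    apply: Creg; apply: (@res_aug_inj _ _ E).
    by rewrite linearZ_LR hc xe linear0.
  by rewrite linear0.
(* [res_d E 0] is injective on the [x]-torsion of [E 0], because [C] has no [x]-torsion. So [rho]
   exists by injectivity of [E 0]; it splits the sequence, and C/xC becomes a direct summand of the
   torsion cycles. *)
have [rho hrho] : exists rho : {linear E 1 -> E 0},
    forall e : E 0, x *: e = 0 -> rho (res_d E 0 e) = e.
  have dec (w : E 1) : exists e : E 0,
      (exists2 e, x *: e = 0 & res_d E 0 e = w) -> x *: e = 0 /\ res_d E 0 e = w.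
    have [[e he1 he2]|n] := pselect (exists2 e, x *: e = 0 & res_d E 0 e = w).
      by exists e.
    by exists 0 => /n.
  have [q hq] := choice dec.
  pose U (w : E 1) := exists2 e, x *: e = 0 & res_d E 0 e = w.
  have hU : is_sub U.
    split; first by exists 0; rewrite ?scaler0 ?linear0.
    move=> r _ _ [e xe <-] [e' xe' <-]; exists (r *: e + e');
      last by rewrite linear_comb.
    by rewrite scalerDr scalerA mulrC -scalerA xe xe' scaler0 addr0.
  have qE e : x *: e = 0 -> q (res_d E 0 e) = e.
    move=> xe; have [|h1 h2] := hq (res_d E 0 e); first by exists e.
    by apply/subr0_eq/tors0; rewrite ?scalerBr ?h1 ?xe ?linearB /= ?h2 ?subrr.
  have [|rho hrho] := @injective_extend R (E 0) (@Einj 0) (E 1) U q hU.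
    move=> r _ _ [e xe <-] [e' xe' <-].
    rewrite -linear_comb !qE ?subrr //.
    by rewrite scalerDr scalerA mulrC -scalerA xe xe' scaler0 addr0.
  exists rho => e xe; rewrite hrho ?qE //; by exists e.
have [u hu] := choice (fun c => res_divisible (res_aug E c)).
(* The map from C/xC to the torsion cycles: divide by [x] in [E 0], apply the differential, and
   remove the component along [rho], which absorbs the choice of the quotient [u]. *)
pose z s := res_d E 0 (u (f s)) - res_d E 0 (rho (res_d E 0 (u (f s)))).
have tors e : x *: e = 0 -> res_d E 0 e - res_d E 0 (rho (res_d E 0 e)) = 0.
  by move=> xe; rewrite hrho ?subrr.
have zlin r s t : a s -> a t -> z (r * s + t) = r *: z s + z t.
  move=> as_ at_; have [c hc] := hf r s t as_ at_.
  apply/subr0_eq; pose eps :=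
    u (f (r * s + t)) - (r *: u (f s) + u (f t)) - res_aug E c.
  have xeps : x *: eps = 0.
    rewrite /eps !scalerBr scalerDr scalerA [x * r]mulrC -scalerA !hu
      -!linear_comb -linearB.
    by rewrite hc -linearZ_LR subrr.
  have := tors _ xeps.
  have -> : res_d E 0 eps = res_d E 0 (u (f (r * s + t))) -
     (r *: res_d E 0 (u (f s)) + res_d E 0 (u (f t))).
    by rewrite /eps !linearB /= res_d_aug subr0 linear_comb.
  rewrite (linearB rho) (linear_comb rho) [in X in _ - X](linearB (res_d E 0))
    (linear_comb (res_d E 0) r (rho _)) => <-.
  by rewrite /z; lmod.
have zx : z x = 0.
  have [c hc] := fx; pose eps := u (f x) - res_aug E c.
  have xeps : x *: eps = 0 by rewrite scalerBr hu hc linearZ_LR subrr.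
  have := tors _ xeps; have -> // : res_d E 0 eps = res_d E 0 (u (f x)).
  by rewrite linearB /= res_d_aug subr0.
have [e he] := injective_ideal (@Einj 1) ha zlin.
have [||e' de' he'] := hbaer a e ha ax.
- by move=> s as_; rewrite -he // /z linearB /= !res_dd subrr.
- by rewrite -he.
have [w hw] := (res_exactS _).1 de'.
have xe' : x *: e' = 0 by rewrite -he' // -he.
have [c0 hc0] : exists c0, res_aug E c0 = x *: w.
  by apply/res_exact0; rewrite linearZ_LR hw.
exists c0 => s as_.
have [c' hc'] : exists c', res_aug E c' = u (f s) - rho (res_d E 0 (u (f s))) - s *: w.
  apply/res_exact0; rewrite !linearB linearZ_LR /= hw -he' // -he //.
  by rewrite /z subrr.
exists c'; apply: (@res_aug_inj _ _ E).
rewrite [RHS]linearZ_LR hc' !scalerBr hu -(linearZ_LR rho) -(linearZ_LR (res_d E 0)).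
by rewrite hu res_d_aug linear0 subr0 scalerA mulrC -scalerA -hc0 linearB linearZ_LR.
Qed.

End Resolution.

Lemma finite_inj_dim_baer (C : lmodType R) : regular C x -> finite_inj_dim C ->
  baer (D := C) x (mulx x).
Proof.
by move=> Creg [E [n hn]]; apply: (baer_of_cycle Creg (cycle_baer1 hn)).
Qed.

End CanonicalProperties.

(** * Isomorphisms, Hom modules and the residue field *)

Lemma lmod_iso_sym (R : comNzRingType) (U V : lmodType R) :
  lmod_iso U V -> lmod_iso V U.
Proof.
move=> [f [g fg gf]]; have [|g' hg'] := @mk_linear _ V U g.
  by move=> r u v; apply: (can_inj fg); rewrite gf linear_comb !gf.
by exists g', f => u; rewrite hg' ?gf ?fg.
Qed.

Lemma lmod_iso_trans (R : comNzRingType) (U V W : lmodType R) :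
  lmod_iso U V -> lmod_iso V W -> lmod_iso U W.
Proof.
move=> [f [f' f1 f2]] [g [g' g1 g2]].
have [|h hh] := @mk_linear _ U W (g \o f).
  by move=> r u v /=; rewrite !linear_comb.
exists h, (f' \o g') => u; first by rewrite hh /= g1 f1.
by rewrite hh /= f2 g2.
Qed.

Section HomModTheory.
Variables (R : comNzRingType) (U V : lmodType R).

Lemma hom_lin (h : HomMod U V) : linear (hom_fun h).
Proof. by case: h => h /= /asboolP. Qed.

Lemma hom_comb (h : HomMod U V) r u v :
  hom_fun h (r *: u + v) = r *: hom_fun h u + hom_fun h v.
Proof. exact: hom_lin. Qed.

Lemma mk_hom (f : U -> V) : linear f -> exists h : HomMod U V, hom_fun h = f.
Proof.
move=> hf; have hf' : f \in @linear_pred R U V by apply/asboolP.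
by exists (Submod hf').
Qed.

Lemma hom_ext (h h' : HomMod U V) : hom_fun h =1 hom_fun h' -> h = h'.
Proof. by move=> e; apply: val_inj; apply: funext. Qed.

Lemma hom_funP (h h' : HomMod U V) r u :
  hom_fun (r *: h + h') u = r *: hom_fun h u + hom_fun h' u.
Proof. by []. Qed.

Lemma hom_funZ r (h : HomMod U V) u : hom_fun (r *: h) u = r *: hom_fun h u.
Proof. by []. Qed.

Lemma hom_funD (h h' : HomMod U V) u : hom_fun (h + h') u = hom_fun h u + hom_fun h' u.
Proof. by []. Qed.

Lemma hom_funB (h h' : HomMod U V) u : hom_fun (h - h') u = hom_fun h u - hom_fun h' u.
Proof. by []. Qed.

Lemma homZ (h : HomMod U V) r u : hom_fun h (r *: u) = r *: hom_fun h u.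
Proof.
have h0 : hom_fun h 0 = 0.
  have := hom_comb h 1 0 0; rewrite !scale1r addr0 => /eqP.
  by rewrite -subr_eq0 opprD addrA subrr sub0r oppr_eq0 => /eqP.
by have := hom_comb h r u 0; rewrite h0 !addr0.
Qed.

Lemma homD (h : HomMod U V) u v : hom_fun h (u + v) = hom_fun h u + hom_fun h v.
Proof. by have := hom_comb h 1 u v; rewrite !scale1r. Qed.

Lemma homN (h : HomMod U V) u : hom_fun h (- u) = - hom_fun h u.
Proof. by rewrite -scaleN1r homZ scaleN1r. Qed.

Lemma homB (h : HomMod U V) u v : hom_fun h (u - v) = hom_fun h u - hom_fun h v.
Proof. by rewrite homD homN. Qed.

Lemma hom0 (h : HomMod U V) : hom_fun h 0 = 0.
Proof. by rewrite -(scale0r (0 : U)) homZ scale0r. Qed.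

End HomModTheory.

Lemma quotmod_scaleE (R : comNzRingType) (V : lmodType R) (U : submodClosed V) a x :
  a *: quotmod_pi U x = quotmod_pi U (a *: x).
Proof. exact: quotmod_piZ. Qed.

Lemma quotmod_pi0 (R : comNzRingType) (V : lmodType R) (U : submodClosed V) :
  0 = quotmod_pi U 0.
Proof. by rewrite -(scale0r (quotmod_pi U 0)) quotmod_scaleE scale0r. Qed.

Lemma quotmod_eq0 (R : comNzRingType) (V : lmodType R) (U : submodClosed V) x :
  quotmod_pi U x = 0 <-> x \in U.
Proof.
split=> [h|h]; last by rewrite quotmod_pi0; apply/quotmod_eq; rewrite subr0.
by rewrite -[x]subr0; apply/quotmod_eq; rewrite h quotmod_pi0.
Qed.

Section ResidueField.
Variables (R : comNzRingType) (m : ideal R).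
Hypothesis mu : forall a, a \notin m -> exists b, b * a = 1.
Hypothesis m1 : 1 \notin m.
Local Notation k := (quotmod m).
Local Notation pik := (@quotmod_pi R _ m).

Definition krepr (q : k) : R := repr q.

Lemma pikK (q : k) : pik (krepr q) = q.
Proof. exact: quotmod_piK. Qed.

Lemma pik_scale (r : R) : pik r = r *: pik 1.
Proof. by rewrite quotmod_scaleE /GRing.scale /= mulr1. Qed.

Lemma pik_eq0 (r : R) : pik r = 0 <-> r \in m.
Proof. exact: quotmod_eq0. Qed.

Lemma hom_residue (V : lmodType R) (e : V) : (forall a, a \in m -> a *: e = 0) ->
  exists h : HomMod k V, forall r, hom_fun h (pik r) = r *: e.
Proof.
move=> me.
have key (q : k) (r s : R) : pik r = q -> pik s = q -> r *: e = s *: e.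
  move=> hr hs; apply/subr0_eq; rewrite -scalerBl me //.
  by apply/quotmod_eq; rewrite hr hs.
have [|h hh] := @mk_hom R k V (fun q => krepr q *: e).
  move=> a q q'; rewrite scalerA -scalerDl; apply: (key (a *: q + q')) => //.
    by rewrite pikK.
  have -> : a *: q + q' = a *: pik (krepr q) + pik (krepr q') by rewrite !pikK.
  by rewrite quotmod_scaleE quotmod_piD.
by exists h => r; rewrite hh; apply: (key (pik r)); first exact: pikK.
Qed.

Lemma hom_residue_pi (V : lmodType R) (h : HomMod k V) q :
  hom_fun h q = krepr q *: hom_fun h (pik 1).
Proof. by rewrite -homZ -pik_scale pikK. Qed.

Lemma hom_residue_kill (V : lmodType R) (h : HomMod k V) (a : R) : a \in m ->
  a *: hom_fun h (pik 1) = 0.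
Proof.
move=> am; transitivity (hom_fun h (a *: pik 1)); first by rewrite homZ.
by rewrite -pik_scale (pik_eq0 a).2 // hom0.
Qed.

Lemma iso_residue (N : lmodType R) : lmod_iso N {ffun 'I_1 -> k} <->
  exists g : N, [/\ g <> 0, forall a, a \in m -> a *: g = 0 &
    forall y, exists r, y = r *: g].
Proof.
split=> [[f [f' f1 f2]]|[g [g0 mg gen]]].
  pose c : {ffun 'I_1 -> k} := [ffun=> pik 1].
  exists (f' c); split.
  - move=> h; have : c ord0 = 0 by rewrite -[c]f2 h linear0 ffunE.
    by rewrite ffunE => /pik_eq0; apply/negP.
  - move=> a am; apply: (can_inj f1); rewrite linear0 linearZ_LR f2.
    apply/ffunP => i; rewrite !ffunE -pik_scale; exact/pik_eq0.
  - move=> y; exists (krepr (f y ord0)); apply: (can_inj f1).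
    rewrite linearZ_LR f2; apply/ffunP => i.
    by rewrite !ffunE -pik_scale pikK (ord1 i).
have inj0 r : r *: g = 0 -> r \in m.
  move=> rg; apply: contrapT => /negP /mu [b br]; apply: g0.
  by rewrite -[g]scale1r -br -scalerA rg scaler0.
have [h hh] := hom_residue mg.
apply: lmod_iso_sym.
have [|f hf] := @mk_linear _ {ffun 'I_1 -> k} N (fun c => hom_fun h (c ord0)).
  by move=> r c c'; rewrite !ffunE hom_comb.
have [q hq] := choice gen.
exists f; exists (fun y => [ffun=> pik (q y)]) => [c|y].
  apply/ffunP => i; rewrite ffunE (ord1 i) hf.
  rewrite -[c ord0 in RHS]pikK; apply/quotmod_eq; apply: inj0.
  by rewrite scalerBl -hq -[c ord0 in X in X - _]pikK hh subrr.
by rewrite hf ffunE hh -hq.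
Qed.

End ResidueField.

(** * Ext^1 of the residue field and the socle of C/xC *)

Section Socle.
Variables (R : comNzRingType) (m : ideal R) (x : R).
Hypothesis Hx : local_param m x.
Local Notation k := (quotmod m).
Local Notation pik := (@quotmod_pi R _ m).

(** The socle of C/xC is a one-dimensional space over the residue field, spanned by the class of
    [s]. *)
Definition simple_socle (C : lmodType R) : Prop := exists s : C,
  [/\ ~ mulx x s, forall a, a \in m -> mulx x (a *: s) &
      forall z : C, (forall a, a \in m -> mulx x (a *: z)) ->
        exists r, mulx x (z - r *: s)].

Variables (C : lmodType R) (E : inj_resolution C).
Hypothesis Creg : regular C x.

(** Divisibility would give only the first property of [u]. Extending the map x c -> c from xC to
    [E 0] over all of C and evaluating at [z] gives the second as well, since [m] multiplies [z]
    into xC. *)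
Lemma socle_lift (z : C) : (forall a, a \in m -> mulx x (a *: z)) ->
  exists u : E 0, x *: u = res_aug E z /\
    forall a, a \in m -> exists c, a *: u = res_aug E c.
Proof.
move=> mz.
have dec (c : C) : exists c', mulx x c -> c = x *: c'.
  have [[c' h]|n] := pselect (mulx x c); first by exists c'.
  by exists 0.
have [q hq] := choice dec.
have qx c : q (x *: c) = c.
  apply/subr0_eq/Creg; rewrite scalerBr -hq ?subrr //; by exists c.
have [|g hg] := @injective_extend R (E 0) (@res_inj _ _ E 0) C (mulx x)
    (fun c => res_aug E (q c)) (is_sub_mulx x).
  move=> r _ _ [c ->] [c' ->].
  have -> : r *: (x *: c) + x *: c' = x *: (r *: c + c') by lmod.
  by rewrite !qx linear_comb subrr.
exists (g z); split.
  by rewrite -linearZ_LR hg ?qx //; exists z.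
move=> a /mz [c hc]; exists c; rewrite -linearZ_LR hc hg ?qx //; by exists c.
Qed.

Lemma torsion_killed (w : E 0) : x *: w = 0 ->
  (forall a, a \in m -> a *: res_d E 0 w = 0) -> forall a, a \in m -> a *: w = 0.
Proof.
move=> xw mw a am; have [|c hc] := (@res_exact0 _ _ E (a *: w)).1.
  by rewrite linearZ_LR mw.
rewrite -hc; have -> : c = 0; last by rewrite linear0.
apply: Creg; apply: (@res_aug_inj _ _ E).
by rewrite linearZ_LR hc scalerA mulrC -scalerA xw scaler0 linear0.
Qed.

Local Notation Z := (submod (@cocycle R C E k 1)).
(** A homomorphism from the residue field is determined by its value at 1, so cocycles become
    elements of [E 1] killed by [m]. *)
Definition cval (z : Z) : E 1 := hom_fun (submod_val z) (pik 1).

Lemma cval_comb r z z' : cval (r *: z + z') = r *: cval z + cval z'.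
Proof. by []. Qed.

Lemma cval_cocycle z : res_d E 1 (cval z) = 0.
Proof. by have /asboolP := submod_valP z; apply. Qed.

Lemma cval_kill z (a : R) : a \in m -> a *: cval z = 0.
Proof. exact: (@hom_residue_kill R m (E 1) (submod_val z) a). Qed.

Lemma mk_cocycle (e : E 1) : res_d E 1 e = 0 -> (forall a, a \in m -> a *: e = 0) ->
  exists z : Z, cval z = e.
Proof.
move=> de me; have [h hh] := hom_residue me.
have hc : h \in @cocycle R C E k 1.
  apply/asboolP => q; rewrite hom_residue_pi hh scale1r linearZ_LR de.
  by rewrite scaler0.
by exists (Submod hc); rewrite /cval /= hh scale1r.
Qed.

Lemma ext_eq0 (z : Z) : @quotmod_pi _ _ (@coboundary_pred R C E k 1) z = 0 <->
  exists u : E 0, (forall a, a \in m -> a *: u = 0) /\ cval z = res_d E 0 u.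
Proof.
rewrite quotmod_eq0; split.
  move=> /asboolP [g hg]; exists (hom_fun g (pik 1)); split=> [a|].
    exact: (@hom_residue_kill R m (E 0) g a).
  by rewrite -hg.
move=> [u [mu hu]]; have [g hg] := hom_residue mu.
apply/asboolP; exists g => q; rewrite [LHS]hom_residue_pi.
by rewrite -[hom_fun _ _]/(cval z) hu hom_residue_pi hg scale1r linearZ_LR.
Qed.

Lemma ext_eq (z z' : Z) r : @quotmod_pi _ _ (@coboundary_pred R C E k 1) z' =
    r *: @quotmod_pi _ _ (@coboundary_pred R C E k 1) z <->
  exists u : E 0, (forall a, a \in m -> a *: u = 0) /\
    cval z' - r *: cval z = res_d E 0 u.
Proof.
have -> : cval z' - r *: cval z = cval (- r *: z + z').
  by rewrite cval_comb addrC scaleNr.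
rewrite -ext_eq0 quotmod_eq0 quotmod_scaleE scaleNr addrC.
exact: quotmod_eq.
Qed.

(* The connecting map Ext^1(k, C) -> Hom(k, C/xC) sends the class of d u to x u. *)
Lemma cocycle_socle (e : E 1) : res_d E 1 e = 0 -> (forall a, a \in m -> a *: e = 0) ->
  exists u z, [/\ res_d E 0 u = e, x *: u = res_aug E z &
    forall a, a \in m -> mulx x (a *: z)].
Proof.
move=> de me; have [u hu] := (@res_exactS _ _ E 0 e).1 de.
have [|z hz] := (@res_exact0 _ _ E (x *: u)).1.
  by rewrite linearZ_LR hu me // (param_mem Hx).
exists u, z; split=> // a am; have [|c hc] := (@res_exact0 _ _ E (a *: u)).1.
  by rewrite linearZ_LR hu me.
exists c; apply: (@res_aug_inj _ _ E).
by rewrite !linearZ_LR hz hc !scalerA mulrC.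
Qed.

(** The connecting map is bijective because [x] is regular on [C] and kills the residue field;
    [socle_lift] inverts it. Generators of the two sides thus correspond. *)
Lemma ext1_socle : lmod_iso (Ext E k 1) {ffun 'I_1 -> k} <-> simple_socle C.
Proof.
pose pi z : Ext E k 1 := @quotmod_pi _ _ (@coboundary_pred R C E k 1) z.
have xm := param_mem Hx.
rewrite (iso_residue (param_unit Hx) (param1 Hx)); split.
- move=> [g [g0 mg gen]]; rewrite -[g]quotmod_piK in g0 gen.
  set z := repr g in g0 gen.
  have [u [s [hu hs ms]]] := cocycle_socle (cval_cocycle z) (@cval_kill z).
  exists s; split=> //.
    move=> [c hc]; apply: g0; apply/ext_eq0; exists (u - res_aug E c); split.
      apply: torsion_killed.
        by rewrite scalerBr hs hc linearZ_LR subrr.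
      move=> a am; rewrite linearB /= res_d_aug subr0 hu.
      exact: cval_kill.
    by rewrite linearB /= res_d_aug subr0 hu.
  move=> z0 mz0; have [u0 [hu0 mu0]] := socle_lift mz0.
  have [||zc hzc] := @mk_cocycle (res_d E 0 u0); first exact: res_dd.
    by move=> a /mu0 [c hc]; rewrite -linearZ_LR hc res_d_aug.
  have [r /ext_eq [u' [mu' hu']]] := gen (pi zc).
  exists r; have [|c hc] := (@res_exact0 _ _ E (u0 - r *: u - u')).1.
    by rewrite !linearB linearZ_LR /= hu -hu' hzc subrr.
  exists c; apply: (@res_aug_inj _ _ E).
  rewrite [RHS]linearZ_LR hc !scalerBr hu0 mu' // subr0.
  by rewrite linearB linearZ_LR /= -hs !scalerA mulrC.
- move=> [s [ns ms gen]]; have [u0 [hu0 mu0]] := socle_lift ms.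
  have [||zc hzc] := @mk_cocycle (res_d E 0 u0); first exact: res_dd.
    by move=> a /mu0 [c hc]; rewrite -linearZ_LR hc res_d_aug.
  exists (pi zc); split.
  + move=> /ext_eq0 [u' [mu' hu']]; apply: ns.
    have [|c hc] := (@res_exact0 _ _ E (u0 - u')).1.
      by rewrite linearB /= -hu' hzc subrr.
    exists c; apply: (@res_aug_inj _ _ E).
    by rewrite linearZ_LR hc scalerBr hu0 mu' // subr0.
  + move=> a am; have -> : (a : R) *: pi zc = pi ((a : R) *: zc) by apply:
      quotmod_scaleE.
    apply/ext_eq0; exists 0; split.
      by move=> b _; rewrite scaler0.
    have -> : cval ((a : R) *: zc) = (a : R) *: cval zc by [].
    by rewrite cval_kill // linear0.
  + move=> y; rewrite -[y]quotmod_piK; set z := repr y.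
    have [u [z0 [hu hz0 mz0]]] := cocycle_socle (cval_cocycle z) (@cval_kill z).
    have [r [c hc]] := gen z0 mz0; exists r; apply/ext_eq.
    exists (u - r *: u0 - res_aug E c).
    have dw : cval z - r *: cval zc = res_d E 0 (u - r *: u0 - res_aug E c).
      by rewrite hzc !(linearB (res_d E 0)) (linearZ_LR (res_d E 0)) res_d_aug subr0 hu.
    split=> //; apply: torsion_killed.
      rewrite !scalerBr hz0 scalerA mulrC -scalerA hu0 -!linearZ_LR -hc.
      by rewrite linearB linearZ_LR /= subrr.
    by move=> a am; rewrite -dw scalerBr scalerA mulrC -scalerA !cval_kill //
      scaler0 subrr.
Qed.

End Socle.

(** * Free modules and finite generation of Hom *)

Section FreeModules.
Variable R : comNzRingType.

Definition freemod n : lmodType R := {ffun 'I_n -> R^o}.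

Definition free_base n (i : 'I_n) : freemod n := [ffun j => (j == i)%:R].

Lemma free_decomp n (c : freemod n) : c = \sum_i c i *: free_base i.
Proof.
apply/ffunP => j; rewrite sum_ffunE (bigD1 j) //= big1 ?addr0.
  by rewrite !ffunE eqxx /GRing.scale /= mulr1.
by move=> i ij; rewrite !ffunE eq_sym (negPf ij) /GRing.scale /= mulr0.
Qed.

Lemma free_map n (V : lmodType R) (w : 'I_n -> V) :
  exists g : {linear freemod n -> V}, forall c, g c = \sum_i c i *: w i.
Proof.
have [|g hg] := @mk_linear _ (freemod n) V (fun c => \sum_i c i *: w i).
  move=> r c d; rewrite scaler_sumr -big_split /=; apply: eq_bigr => i _.
  by rewrite !ffunE scalerDl scalerA.
by exists g.
Qed.

Lemma free_map_base n (V : lmodType R) (w : 'I_n -> V) :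
  exists g : {linear freemod n -> V}, forall i, g (free_base i) = w i.
Proof.
have [g hg] := free_map w; exists g => i.
rewrite hg (bigD1 i) //= big1 ?addr0; first by rewrite ffunE eqxx scale1r.
by move=> j ji; rewrite ffunE (negPf ji) scale0r.
Qed.

Lemma linmod_sum n (V D : lmodType R) (X : D -> Prop) (f : V -> D) (c :
  'I_n -> R) (v : 'I_n -> V) :
  is_sub X -> linmod (fun=> True) X f ->
  X (f (\sum_i c i *: v i) - \sum_i c i *: f (v i)).
Proof.
move=> hX hf; apply: (big_ind2 (fun a b => X (f a - b))).
- by rewrite subr0; apply: (linmod0 (is_sub_full V) hX hf).
- move=> a a' b b' h1 h2.
  have h3 := linmodD (u := a) (v := b) hf I I.
  by have := is_subD hX (is_subD hX h3 h1) h2; congr X; lmod.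
- by move=> i _; exact: (linmodZ _ (is_sub_full V) hX hf I).
Qed.

Lemma free_lift_mod n (D : lmodType R) (X : D -> Prop) (f : freemod n -> D) :
  is_sub X -> linmod (fun=> True) X f ->
  exists g : {linear freemod n -> D}, forall c, X (f c - g c).
Proof.
move=> hX hf; have [g hg] := free_map (fun i : 'I_n => f (free_base i)).
by exists g => c; rewrite hg {1}[c]free_decomp;
  exact: (@linmod_sum n _ _ X f c _ hX hf).
Qed.

Lemma free_ext n (V : lmodType R) (f g : {linear freemod n -> V}) :
  (forall i, f (free_base i) = g (free_base i)) -> f =1 g.
Proof.
move=> h c; rewrite [c]free_decomp !linear_sum; apply: eq_bigr => i _.
by rewrite !linearZ_LR h.
Qed.

Lemma free_cover (N : lmodType R) : fin_gen N ->
  exists n (p : {linear freemod n -> N}), forall y, exists c, p c = y.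
Proof.
move=> [n [v hv]]; have [p hp] := free_map v; exists n, p => y.
have [c ->] := hv y; exists [ffun i => c i]; rewrite hp.
by apply: eq_bigr => i _; rewrite ffunE.
Qed.

Lemma factor (V N D : lmodType R) (p : {linear V -> N}) (f : {linear V -> D}) :
  (forall y, exists c, p c = y) -> (forall c, p c = 0 -> f c = 0) ->
  exists g : {linear N -> D}, forall c, g (p c) = f c.
Proof.
move=> hp hf; have [q hq] := choice hp.
have key c c' : p c = p c' -> f c = f c'.
  by move=> h; apply/subr0_eq; rewrite -linearB hf // linearB /= h subrr.
have [|g hg] := @mk_linear _ N D (f \o q).
  by move=> r y y' /=; rewrite -linear_comb; apply: key; rewrite linear_comb !hq.
by exists g => c; rewrite hg; apply: key; rewrite hq.
Qed.

Lemma linear_sub (V D : lmodType R) (f g : {linear V -> D}) :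
  exists h : {linear V -> D}, forall v, h v = f v - g v.
Proof.
have [|h hh] := @mk_linear _ V D (fun v => f v - g v); last by exists h.
by move=> r u v; rewrite !linear_comb; lmod.
Qed.

Lemma linear_scale (V D : lmodType R) x (f : {linear V -> D}) :
  exists h : {linear V -> D}, forall v, h v = x *: f v.
Proof.
have [|h hh] := @mk_linear _ V D (fun v => x *: f v); last by exists h.
by move=> r u v; rewrite !linear_comb; lmod.
Qed.

Lemma linear_compose (U V D : lmodType R) (f : {linear V -> D}) (g : {linear U -> V}) :
  exists h : {linear U -> D}, forall v, h v = f (g v).
Proof.
have [|h hh] := @mk_linear _ U D (f \o g); last by exists h.
by move=> r u v /=; rewrite !linear_comb.
Qed.

Lemma fin_gen_free n : fin_gen (freemod n).
Proof. by exists n, (@free_base n) => c; exists c; apply: free_decomp. Qed.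

Lemma fin_gen_ffun n (V : lmodType R) : fin_gen V -> fin_gen {ffun 'I_n -> V}.
Proof.
move=> /fin_genP [s hs].
pose w := [seq [ffun j => if j == i then v else 0] :
  {ffun 'I_n -> V} | i <- enum 'I_n, v <- s].
apply/fin_genP; exists w => f.
have -> : f = \sum_i [ffun j => if j == i then f i else 0].
  apply/ffunP => j; rewrite sum_ffunE (bigD1 j) //= big1 ?addr0.
    by rewrite ffunE eqxx.
  by move=> i ij; rewrite ffunE eq_sym (negPf ij).
have hw := is_sub_span w.
apply: (big_ind (spanned w)); [by case: hw|by move=> ? ?; apply: is_subD|].
move=> i _; have [|g hg] :=
  @mk_linear _ V {ffun 'I_n -> V} (fun v => [ffun j => if j == i then v else 0]).
  move=> r u v; apply/ffunP => j; rewrite !ffunE; case: ifP => // _.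
  by rewrite scaler0 addr0.
rewrite -hg; have hU : is_sub (fun v => spanned w (g v)).
  split; first by rewrite linear0; case: hw.
  by move=> r u v hu hv; rewrite linear_comb; apply: hw.2.
apply: (span_sub hU) (hs _) => v hv; apply: span_mem; rewrite hg.
by apply/allpairsP; exists (i, v); rewrite mem_enum.
Qed.

Hypothesis hR : noeth R.

Lemma fin_gen_inj (U V : lmodType R) (f : {linear U -> V}) : fin_gen V ->
  injective f -> fin_gen U.
Proof.
move=> hV finj; pose W v := exists u, f u = v.
have hW : is_sub W.
  split; first by exists 0; rewrite linear0.
  by move=> r _ _ [u <-] [u' <-]; exists (r *: u + u'); rewrite linear_comb.
have [s [hs1 hs2]] := fg_seq hW (sub_fg hR hV hW).
have [t ht] : exists t : seq U, s = map f t.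
  elim: s hs1 {hs2} => [|y s IH] hs; first by exists [::].
  have [t ->] := IH (fun r hr => hs r (@mem_behead _ (y :: s) r hr)).
  by have [u <-] := hs y (mem_head _ _); exists (u :: t).
apply/fin_genP; exists t => u.
have key t' v : spanned (map f t') v -> exists2 u, spanned t' u & f u = v.
  elim: t' v => [|y t' IH] v /=; first by move=> ->; exists 0; rewrite ?linear0.
  move=> [r [w [/IH [u' h1 h2] ->]]]; exists (r *: y + u'); first by exists r, u'.
  by rewrite linear_comb h2.
have [|u' hu' /finj <- //] := key t (f u).
by rewrite -ht; apply: hs2; exists u.
Qed.

(** Values on generators embed Hom(U, V) in a power of V. *)
Lemma fin_gen_hom (U V : lmodType R) : fin_gen U -> fin_gen V ->
  fin_gen (HomMod U V).
Proof.
move=> hU hV; have [n [v hv]] := hU.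
have [|f hf] := @mk_linear _ (HomMod U V) {ffun 'I_n -> V} (fun h => [ffun i =>
  hom_fun h (v i)]).
  by move=> r h h'; apply/ffunP => i; rewrite !ffunE.
apply: (fin_gen_inj (f := f)); first exact: fin_gen_ffun.
move=> h h'; rewrite !hf => /ffunP e; apply: hom_ext => u.
have [c ->] := hv u.
have [g hg] := mk_linear (hom_lin h); have [g' hg'] := mk_linear (hom_lin h').
rewrite -hg -hg' !linear_sum; apply: eq_bigr => i _.
by rewrite !linearZ_LR hg hg'; have := e i; rewrite !ffunE => ->.
Qed.

Lemma fin_gen_submod (V : lmodType R) (S : submodClosed V) : fin_gen V ->
  fin_gen (submod S).
Proof.
move=> hV; have [f hf] := mk_linear (@submod_val_linear R V S).
apply: (fin_gen_inj hV (f := f)) => u v; rewrite !hf => h; exact: val_inj.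
Qed.

End FreeModules.
Arguments free_base {R n} i.

(** * Dualizing modules: lifting from C/xC and vanishing of Ext *)

Section Dualizing.
Variables (R : comNzRingType) (m : ideal R) (x : R).
Hypothesis Hx : local_param m x.

(* In dimension one, C is canonical when C/xC is an injective hull of the
   residue field over R/x. *)
Definition dualizing (C : lmodType R) : Prop :=
  [/\ fin_gen C, regular C x, baer (D := C) x (mulx x) & simple_socle m x C].

Lemma canonical_dualizing (C : lmodType R) : krull_dim R 1 ->
  canonical_module m C -> dualizing C.
Proof.
move=> hdim [CM [t [E [ht hE]]] hinj].
have h1 := maximal_CM_depth1 hdim CM.
have Creg := regular_of_depth1 Hx h1.
split=> //; first by case: CM.
  exact: (finite_inj_dim_baer Hx Creg hinj).
have t1 := depth_unique ht h1; move: hE; rewrite t1.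
by move=> hE; apply/(ext1_socle Hx E Creg).
Qed.

(* If y in C is regular and s generates the socle of C/xC, write ys = xt;
   then t is a socle element of C/yC, so no element of m is regular on C/yC. *)
Lemma dualizing_depth (C : lmodType R) : regular C x -> simple_socle m x C ->
  depth m C 1.
Proof.
move=> Creg [s [ns ms _]]; split.
  exists [:: x]; split=> //.
    by move=> y; rewrite inE => /eqP ->; apply: param_mem Hx.
  by apply/regular_seq1; split=> //; exists s.
move=> [|y1 [|y2 ys]] // hm [hreg _].
have y1m : y1 \in m by apply: hm; rewrite inE eqxx.
have y2m : y2 \in m by apply: hm; rewrite !inE eqxx orbT.
have y1reg (c : C) : y1 *: c = 0 -> c = 0.
  move=> h; apply/in_seq_mul_nil.
  by apply: (hreg 0%N isT c); apply/in_seq_mul_nil.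
have [t ht] := ms _ y1m.
have mt a : a \in m -> mulx y1 (a *: t).
  move=> am; have [c hc] := ms _ am; exists c; apply/subr0_eq/Creg.
  rewrite scalerBr; apply/eqP; rewrite subr_eq0; apply/eqP.
  have -> : x *: (a *: t) = a *: (x *: t) by lmod.
  rewrite -ht; have -> : a *: (y1 *: s) = y1 *: (a *: s) by lmod.
  by rewrite hc; lmod.
have /in_seq_mul1 [c hc] : in_seq_mul [:: y1] t.
  by apply: (hreg 1%N isT t); apply/in_seq_mul1; apply: mt.
exfalso; apply: ns; exists c; apply/subr0_eq/y1reg.
by rewrite scalerBr ht hc; lmod.
Qed.

(** Nakayama is applied to the image and then to the kernel. If f u = 0 then u = x k with x f(k) =
    0, and regularity of [V] puts k in the kernel, which is therefore x times itself. *)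
Lemma bijective_mod_x (U V : lmodType R) (f : {linear U -> V}) :
  fin_gen U -> fin_gen V -> regular V x ->
  (forall u, mulx x (f u) -> mulx x u) ->
  (forall v, exists u, mulx x (v - f u)) -> bijective f.
Proof.
move=> hU hV Vreg finj fsurj.
have surj v : exists u, f u = v.
  apply: (nakayama_full Hx (U := fun v => exists u, f u = v) hV).
    split; first by exists 0; rewrite linear0.
    by move=> r _ _ [u <-] [u' <-]; exists (r *: u + u'); rewrite linear_comb.
  move=> w; have [u [k hk]] := fsurj w; exists (f u), k; split; first by exists u.
  by rewrite -hk addrC subrK.
have hK : is_sub (fun u => f u = 0).
  split; first by rewrite linear0.
  by move=> r u v hu hv; rewrite linear_comb hu hv scaler0 addr0.
have [s [hs1 hs2]] := fg_seq hK (sub_fg (param_noeth Hx) hU hK).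
have inj u : f u = 0 -> u = 0.
  apply: (nakayama Hx (s := s) (is_sub_zero _) hK) => //.
  - by move=> v ->; rewrite linear0.
  - by move=> v /hs2 hv; apply: (sum_subr (is_sub_zero U)).
  - move=> v hv; have [|k hk] := finj v; first by exists 0; rewrite hv scaler0.
    exists 0, k; split=> //; last by rewrite add0r.
    by apply: Vreg; rewrite -linearZ_LR -hk.
have [g hg] := choice surj; exists g => // u.
by apply/subr0_eq/inj; rewrite linearB /= hg subrr.
Qed.

Lemma free_regular n : regular (freemod R n) x.
Proof.
move=> v /ffunP xv; apply/ffunP => j; have := xv j; rewrite !ffunE.
exact: (param_reg Hx).
Qed.

Variable C : lmodType R.
Hypotheses (Cfg : fin_gen C) (Creg : regular C x).
Local Notation xC := (@mulx R C x).
Hypothesis Cbaer : baer x xC.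
Let hxC : is_sub xC := is_sub_mulx x.

Lemma linmod_mulx (V : lmodType R) (f : V -> C) v :
  linmod (fun=> True) xC f -> xC (f (x *: v)).
Proof.
move=> hf; have h := linmodZ x (is_sub_full V) hxC hf (I : True) (u := v).
by apply: (is_subBl hxC _ h); exists (f v).
Qed.

Lemma divide_hom (V : lmodType R) (h : HomMod V C) :
  (forall p, mulx x (hom_fun h p)) -> mulx x h.
Proof.
move=> hh; have [q hq] := choice hh.
have [|h' hh'] := @mk_hom R V C q.
  move=> r u v; apply/subr0_eq/Creg.
  by rewrite scalerBr -hq scalerDr scalerA mulrC -scalerA -!hq hom_comb subrr.
by exists h'; apply: hom_ext => u; rewrite hom_funZ hh'.
Qed.

Lemma extend_full (V : lmodType R) (B : V -> Prop) (f : V -> C) :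
  fin_gen V -> is_sub B -> (forall v, B (x *: v)) -> linmod B xC f ->
  (forall v, xC (f (x *: v))) ->
  exists g, linmod (fun=> True) xC g /\ forall b, B b -> xC (g b - f b).
Proof.
move=> /fin_genP [s hs] hB Bx hf fx; apply: (extend_fg hxC Cbaer hB Bx hf fx (s := s)).
by move=> v; apply: sum_subr.
Qed.

(* Ext^1(F/W, C) = 0 for F free: by Nakayama it is enough to extend maps modulo
   x, and C/xC is injective over R/x. *)
Lemma extend_from_saturated n (W : freemod R n -> Prop) (h :
  freemod R n -> C) : is_sub W ->
  (forall v, W (x *: v) -> W v) -> linmod W (fun c => c = 0) h ->
  exists g : {linear freemod R n -> C}, forall v, W v -> g v = h v.
Proof.
move=> hW Wx hh; have [S hS] := sub_closed hW.
have SW (s : submod S) : W (submod_val s) by apply/hS; apply: submod_valP.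
(* The homomorphisms on [W] that extend to the free module; Nakayama is applied to them inside
   Hom(W, C). *)
pose restr (h : HomMod (submod S) C) := exists g : {linear freemod R n -> C},
  forall s, hom_fun h s = g (submod_val s).
have hF := fin_gen_free R n.
have hHfg : fin_gen (HomMod (submod S) C).
  by apply: fin_gen_hom => //;
    [apply: param_noeth Hx|apply: fin_gen_submod => //; apply: param_noeth Hx].
have hrestr : is_sub restr.
  split.
    have [|g hg] := @mk_linear _ (freemod R n) C (fun=> 0);
      last by exists g => s; rewrite hg.
    by move=> r u v; rewrite scaler0 addr0.
  move=> r h1 h2 [g1 hg1] [g2 hg2].
  have [|g hg] := @mk_linear _ (freemod R n) C (fun v => r *: g1 v + g2 v).
    by move=> a u v; rewrite !linear_comb; lmod.
  by exists g => s; rewrite hg hom_funP hg1 hg2.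
have [H hH] : exists H : HomMod (submod S) C, forall s, hom_fun H s = h (submod_val s).
  have [|H hH] := @mk_hom R (submod S) C (h \o @submod_val _ _ S);
    last by exists H => s; rewrite hH.
  by move=> r u v; apply: (linmod_eq hh r (SW u) (SW v)).
suff [g hg] : restr H by exists g => v /hS hv; rewrite -(hg (Submod hv)) hH.
apply: (nakayama_full Hx hHfg hrestr) => {H hH h hh} H.
have HS (u v : freemod R n) (hu : u \in S) (hv : v \in S) : x *: v = u ->
    hom_fun H (Submod hu) = x *: hom_fun H (Submod hv).
  by move=> e; rewrite -homZ; congr (hom_fun H _); apply: val_inj.
have dec v : exists s : submod S, sum_sub W (mulx x) v -> mulx x (v - submod_val s).
  have [[w Ww wv]|nv] := pselect (sum_sub W (mulx x) v).
    by exists (Submod ((hS w).2 Ww)).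
  by exists 0 => /nv.
have [q hq] := choice dec.
(* Here saturation enters: an element of [W] divisible by [x] is [x] times an element of [W]. Hence
   [H] induces a map to C/xC on [W] plus the [x]-multiples, killing the latter. *)
have key (s s' : submod S) : mulx x (submod_val s - submod_val s') ->
    xC (hom_fun H s - hom_fun H s').
  move=> [k hk]; have Wk : k \in S.
    by apply/hS/Wx; rewrite -hk; apply/hS/(is_subB (is_sub_closed S));
      apply: submod_valP.
  exists (hom_fun H (Submod Wk)); rewrite -homB -homZ; congr (hom_fun H _).
  exact: val_inj.
have hB := is_sub_sum hW (is_sub_mulx (V := freemod R n) x).
have WB s : sum_sub W (mulx x) (submod_val (s : submod S)).
  by apply: sum_subl => //; apply: is_sub_mulx.
have hx := is_sub_mulx (V := freemod R n) x.
have [|||g [hg gH]] := @extend_full (freemod R n) (sum_sub W (mulx x)) (fun v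
  => hom_fun H (q v)) hF hB.
- by move=> v; apply: sum_subr => //; exists v.
- move=> r u v hu hv; rewrite -hom_comb; apply: key.
  have h1 := hq _ hu; have h2 := hq _ hv; have h3 := hq _ (hB.2 r _ _ hu hv).
  have := is_subB hx (hx.2 r _ _ h1 h2) h3.
  by rewrite [submod_val (_ *: _ + _)]submod_val_linear; congr mulx; lmod.
- move=> v; have h : mulx x (x *: v) by exists v.
  suff : xC (hom_fun H (q (x *: v)) - hom_fun H 0) by rewrite hom0 subr0.
  apply: key; have hs := hq (x *: v) (sum_subr hW h).
  rewrite -[submod_val 0]/(0 : freemod R n).
  by have := is_subB hx h hs; congr mulx; lmod.
have [g0 hg0] := free_lift_mod hxC hg.
have dH s : xC (hom_fun H s - g0 (submod_val s)).
  have h1 := hg0 (submod_val s); have h2 := gH _ (WB s).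
  have h3 := key _ _ (hq _ (WB s)).
  by have := is_subD hxC (is_subB hxC h3 h2) h1; congr xC; lmod.
have [q' hq'] := choice dH.
have [|k hk] := @mk_hom R (submod S) C q'.
  move=> r u v; apply/subr0_eq/Creg;
    rewrite scalerBr -hq' scalerDr scalerA mulrC -scalerA -!hq'.
  by rewrite hom_comb submod_val_linear linear_comb; lmod.
have [|k0 hk0] := @mk_hom R (submod S) C (fun s => g0 (submod_val s)).
  by move=> r u v; rewrite submod_val_linear linear_comb.
exists k0, k; split; first by exists g0 => s; rewrite hk0.
by apply: hom_ext => s; rewrite hom_funD hom_funZ hk hk0 -hq' addrC subrK.
Qed.

Lemma ker_sub (V D : lmodType R) (f : {linear V -> D}) : is_sub (fun v => f v = 0).
Proof.
split; first exact: linear0.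
by move=> r u v hu hv; rewrite linear_comb hu hv scaler0 addr0.
Qed.

(** After lifting over a free cover of [N], the lift equals x h on the kernel. That kernel is
    saturated since [N] is regular, so h extends to the free module, and subtracting x times the
    extension gives a map that factors through [N]. *)
Lemma lift_mod_x (N : lmodType R) (f : N -> C) : fin_gen N -> regular N x ->
  linmod (fun=> True) xC f ->
  exists g : {linear N -> C}, forall v, xC (f v - g v).
Proof.
move=> Nfg Nreg hf; have [n [p hp]] := free_cover Nfg.
have [|g0 hg0] := @free_lift_mod R n C xC (f \o p) hxC.
  by move=> r u v _ _ /=; rewrite linear_comb; apply: hf.
have hW := ker_sub p.
have g0W v : p v = 0 -> exists c, g0 v = x *: c.
  move=> pv; have := hg0 v; rewrite /= pv => h.
  exact: (is_subBr hxC (linmod0 (is_sub_full N) hxC hf) h).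
have dec v : exists c, p v = 0 -> g0 v = x *: c.
  by have [/g0W [c hc]|n0] := pselect (p v = 0); [exists c|exists 0].
have [h hh] := choice dec.
have [||g1 hg1] := @extend_from_saturated n (fun v => p v = 0) h hW.
- by move=> v; rewrite linearZ_LR => /Nreg.
- move=> r u v hu hv; apply: Creg.
  rewrite scalerBr -hh; last exact: hW.2.
  by rewrite scalerDr scalerA mulrC -scalerA -!hh // linear_comb subrr.
have [k1 hk1] := linear_scale x g1; have [k hk] := linear_sub g0 k1.
have [|g hg] := factor hp (f := k).
  by move=> c pc; rewrite hk hk1 hg1 // -hh // subrr.
exists g => v; have [c <-] := hp v; rewrite hg hk hk1.
have h1 := hg0 c; have h2 : xC (x *: g1 c) by exists (g1 c).
by have := is_subD hxC h1 h2; congr xC; rewrite /=; lmod.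
Qed.

(* That is, Ext^(i+1)(N, C) = 0. *)
Lemma lift_cycle (E : inj_resolution C) i (N : lmodType R) (f : {linear N -> E i.+1}) :
  fin_gen N -> regular N x -> (forall y, res_d E i.+1 (f y) = 0) ->
  exists g : {linear N -> E i}, forall y, res_d E i (g y) = f y.
Proof.
elim: i N f => [|i IH] N f Nfg Nreg df; have [n [p hp]] := free_cover Nfg.
all: have hW := ker_sub p.
all: have [w hw] := choice (fun j => (res_exactS (f (p (free_base (n :=
  n) j)))).1 (df _)).
all: have [g0 hg0] := free_map_base w.
all: have [f1 hf1] := linear_compose f p.
all: have [dg0 hdg0] := linear_compose (res_d E _) g0.
all: have dg c : res_d E _ (g0 c) = f (p c) by rewrite -hdg0 -hf1; apply: free_ext => j;
  rewrite hdg0 hf1 hg0 hw.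
(* In degree zero the lift to the free cover carries the kernel into [C], and this map extends to
   the whole free module. *)
- have dec c : exists y, p c = 0 -> res_aug E y = g0 c.
    have [pc|pc] := pselect (p c = 0); last by exists 0.
    by have [|y hy] := (res_exact0 (g0 c)).1; [rewrite dg pc linear0|exists y].
  have [h hh] := choice dec.
  have [||g1 hg1] := @extend_from_saturated n (fun v => p v = 0) h hW.
  + by move=> v; rewrite linearZ_LR => /Nreg.
  + move=> r u v hu hv; apply/eqP; rewrite subr_eq0; apply/eqP;
      apply: (@res_aug_inj _ _ E).
    by rewrite linear_comb !hh //; [rewrite linear_comb|apply: hW.2].
  have [k1 hk1] := linear_compose (res_aug E) g1; have [k hk] := linear_sub g0 k1.
  have [|g hg] := factor hp (f := k).
    by move=> c pc; rewrite hk hk1 hg1 // hh // subrr.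
  exists g => y; have [c <-] := hp y.
  by rewrite hg hk hk1 linearB /= res_d_aug subr0 dg.
(* Dimension shift: the kernel of the cover is finitely generated and [x]-regular, so on it [g0]
   lifts one degree down. The lift extends by injectivity of [E i], and its differential is
   subtracted. *)
- have [S hS] := sub_closed hW.
  have [iota hiota] := mk_linear (@submod_val_linear R _ S).
  have [f2 hf2] := linear_compose g0 iota.
  have [|||g1 hg1] := IH (submod S) f2.
  + by apply: fin_gen_submod; [apply: param_noeth Hx|apply: fin_gen_free].
  + move=> s xs; apply: val_inj; apply: free_regular.
    by rewrite -[LHS]/(submod_val (x *: s)) xs.
  + move=> s; rewrite hf2 hiota dg ((hS _).1 (submod_valP s)); exact: linear0.
  have dec v : exists e, forall hv : v \in S, e = g1 (Submod hv).
    have [hv|nv] := pselect (is_true (v \in S)); last by exists 0.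
    by exists (g1 (Submod hv)) => hv'; congr (g1 _); apply: val_inj.
  have [h hh] := choice dec.
  have [|g2 hg2] := @injective_extend R (E i) (@res_inj _ _ E i) (freemod R n)
    (fun v => p v = 0) h hW.
    move=> r u v /hS hu /hS hv; rewrite (hh _ hu) (hh _ hv).
    have huv : r *: u + v \in S by apply: (is_sub_closed S).2.
    rewrite (hh _ huv) -linear_comb; apply/eqP; rewrite subr_eq0; apply/eqP;
      congr (g1 _).
    exact: val_inj.
  have [k1 hk1] := linear_compose (res_d E i) g2; have [k hk] := linear_sub g0 k1.
  have [|g hg] := factor hp (f := k).
    move=> c pc; rewrite hk hk1 hg2 //; have /hS hc := pc.
    by rewrite (hh _ hc) hg1 hf2 hiota subrr.
  exists g => y; have [c <-] := hp y.
  by rewrite hg hk hk1 linearB /= res_dd subr0 dg.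
Qed.

End Dualizing.

(** * Endomorphisms, reflexivity and uniqueness *)

Section Duality.
Variables (R : comNzRingType) (m : ideal R) (x : R).
Hypothesis Hx : local_param m x.

Section OneModule.
Variable C : lmodType R.
Hypothesis HC : dualizing m x C.
Local Notation xC := (@mulx R C x).
Let hxC : is_sub xC := is_sub_mulx x.
Let Cfg : fin_gen C. Proof. by case: HC. Qed.
Let Creg : regular C x. Proof. by case: HC. Qed.
Let Cbaer : baer x xC. Proof. by case: HC. Qed.
Let Csoc : simple_socle m x C. Proof. by case: HC. Qed.

(** Some multiple of [y] is a socle element modulo [B]. It is sent to the socle generator of C/xC,
    and the map extends because C/xC is injective over R/x. *)
Lemma cogenerator (V : lmodType R) (B : V -> Prop) y : fin_gen V -> is_sub B ->
  (forall v, B (x *: v)) -> ~ B y ->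
  exists f : V -> C, [/\ linmod (fun=> True) xC f, forall b, B b ->
    xC (f b) & ~ xC (f y)].
Proof.
move=> Vfg hB Bx nBy; have [s [ns ms _]] := Csoc.
have [r [nr mr]] := socle_elt Hx hB nBy (Bx y).
have [||g [hg g0 gs]] := @extend_one R V C B xC (fun=> 0) (r *: y) s hB hxC.
- by move=> a u v _ _; rewrite scaler0 addr0 subr0; case: hxC.
- move=> a Ba; have [am|am] := boolP (a \in m).
    by rewrite sub0r; apply: is_subN => //; apply: ms.
  by case: nr; apply: (unit_cancel Hx hB am Ba).
have hBl := is_sub_sum hB (is_sub_line (r *: y)).
have BB b : B b -> sum_sub B (line (r *: y)) b.
  by apply: sum_subl; apply: is_sub_line.
have [||f [hf fg]] := extend_full Cbaer Vfg hBl _ hg.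
- by move=> v; apply: BB.
- by move=> v; have := g0 _ (Bx v); rewrite subr0.
exists f; split=> //.
  by move=> b Bb; have := fg _ (BB _ Bb); apply: is_subBl => //;
    have := g0 _ Bb; rewrite subr0.
move=> fy; apply: ns.
have h1 : xC (f (r *: y)).
  by apply: (is_subBl hxC _ (linmodZ r (is_sub_full V) hxC hf (I : True)));
    apply: is_subZ.
have h2 : xC (f (r *: y) - g (r *: y)).
  by apply: fg; apply: sum_subr => //; exists 1; rewrite scale1r.
exact: (is_subBr hxC (is_subBr hxC h1 h2) gs).
Qed.

(* Induction over ideals a: modulo x, a map on the elements killed by a is
   scalar. If a' = a + Rs with ms in a, then s maps the elements killed by a into
   the socle, with kernel the elements killed by a'. *)
Lemma endo_scalar_aux (a : R^o -> Prop) : is_sub a -> forall f : C -> C,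
  linmod (fun c => forall s, a s -> xC (s *: c)) xC f ->
  (forall c, xC (f (x *: c))) -> a x ->
  exists r, forall c, (forall s, a s -> xC (s *: c)) -> xC (f c - r *: c).
Proof.
move: a; apply: (noeth_ind (param_noeth Hx)) => a ha IH f hf fx ax.
pose K (b : R^o -> Prop) c := forall s, b s -> xC (s *: c).
have hK b : is_sub (K b).
  split=> [s _|r u v hu hv s bs]; first by rewrite scaler0; case: hxC.
  have -> : s *: (r *: u + v) = r *: (s *: u) + s *: v by lmod.
  by apply: hxC.2; [apply: hu|apply: hv].
have [a1|na1] := pselect (a 1).
  exists 0 => c /(_ 1 a1); rewrite scale1r scale0r subr0 => -[c' ->]; exact: fx.
have ax1 : a (x *: 1) by rewrite /GRing.scale /= mulr1.
have [r0 [nar mr]] := socle_elt Hx ha na1 ax1.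
set s := r0 *: 1 in nar mr.
have ha' := is_sub_sum ha (is_sub_line s).
have aa' t : a t -> sum_sub a (line s) t by apply: sum_subl; apply: is_sub_line.
have KK c : K (sum_sub a (line s)) c -> K a c by move=> h t at_; apply/h/aa'.
have as_ : sum_sub a (line s) s by apply: sum_subr => //; exists 1; rewrite scale1r.
have K'P c : K a c -> xC ((s : R) *: c) -> K (sum_sub a (line s)) c.
  move=> h1 h2 t [b ab [d hd]].
  rewrite -[t](subrK b) hd scalerDl -scalerA; apply: is_subD (h1 _ ab) => //.
  exact: is_subZ.
have [||r hr] := IH _ ha' aa' _ f _ fx (aa' _ ax).
- by exists s.
- by move=> t u v hu hv; apply: hf; apply: KK.
have [same|] := pselect (forall c, K a c -> xC ((s : R) *: c)).
  by exists r => c hc; apply/hr/K'P => //; apply: same.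
move=> /existsNP [e1] /not_implyP [Ke1 ns1].
have [sg [nsg msg gen]] := Csoc.
have sK c : K a c -> exists t, xC ((s : R) *: c - t *: sg).
  move=> hc; apply: gen => b bm.
  by rewrite scalerA; apply: hc; apply: mr.
have [t1 ht1] := sK _ Ke1.
have [t1m|/(param_unit Hx) [b bt]] := boolP (t1 \in m).
  by case: ns1; apply: (is_subBl hxC (msg _ t1m) ht1).
(* Rescaled so that [s] takes [e0] exactly to the socle generator; [t1] is a unit, since otherwise
   [s] would kill [e1] modulo [x]. *)
pose e0 := b *: e1.
have Ke0 : K a e0 by exact: (is_subZ b (hK a) Ke1).
have se0 : xC ((s : R) *: e0 - sg).
  have -> : (s : R) *: e0 - sg = b *: ((s : R) *: e1 - t1 *: sg).
    by rewrite scalerBr [b *: (t1 *: _)]scalerA bt scale1r /e0; lmod.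
  exact: is_subZ.
have [v hv] : exists v, xC ((f e0 - r *: e0) - v *: sg).
  apply: gen => u um.
  have Kue0 : K (sum_sub a (line s)) (u *: e0).
    apply: K'P; first exact: (is_subZ u (hK a) Ke0).
    rewrite scalerA mulrC -scalerA.
    have := is_subD hxC (is_subZ u hxC se0) (msg _ um); congr xC; lmod.
  have h1 := hr _ Kue0; have h2 := linmodZ u (hK a) hxC hf Ke0.
  by have := is_subB hxC h1 h2; congr xC; lmod.
(* If s c = t sg modulo x, then c - t e0 is killed by the larger ideal, where [f] is multiplication
   by [r]; the error v sg at [e0] contributes t v sg = v s c. *)
exists (r + v * s) => c Kc.
have [t ht] := sK _ Kc.
have Kd : K a (- t *: e0 + c) by apply: (hK a).2.
have K'd : K (sum_sub a (line s)) (- t *: e0 + c).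
  apply: K'P => //; have := is_subB hxC ht (is_subZ t hxC se0).
  by congr xC; lmod.
have h1 := hr _ K'd; have h2 := hf (- t) _ _ Ke0 Kc.
have h3 := is_subZ t hxC hv.
have h4 := is_subZ v hxC ht.
have := is_subB hxC (is_subD hxC (is_subB hxC h1 h2) h3) h4.
by congr xC; lmod.
Qed.

(** Matlis duality over R/x: the endomorphisms of the injective hull of the residue field are
    scalars. It is the case of the ideal generated by [x], whose elements kill all of C/xC. *)
Lemma endo_scalar (f : C -> C) : linmod (fun=> True) xC f ->
  exists r, forall c, xC (f c - r *: c).
Proof.
move=> hf; have [|||r hr] := @endo_scalar_aux (mulx x) (is_sub_mulx x) f.
- by move=> r u v _ _; apply: hf.
- by move=> c; apply: linmod_mulx.
- by exists 1; rewrite /GRing.scale /= mulr1.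
exists r => c; apply: hr => s [k ->]; exists (k *: c).
by rewrite scalerA.
Qed.

(* If xi in Hom(Hom(N, C), C) is not an evaluation modulo x on the generators
   phi_i of Hom(N, C), then a map (C/xC)^n -> C/xC separates it from the
   evaluations; this map is a row of scalars r_i, so sum r_i phi_i is divisible by
   x while sum r_i xi(phi_i) is not. *)
Lemma reflexive (N : lmodType R) : fin_gen N -> regular N x ->
  exists2 f : {linear N -> HomMod (HomMod N C) C}, bijective f &
    forall y h, hom_fun (f y) h = hom_fun h y.
Proof.
move=> Nfg Nreg.
have mkev y : exists e : HomMod (HomMod N C) C, forall h, hom_fun e h = hom_fun h y.
  by have [|e he] := @mk_hom R (HomMod N C) C (fun h => hom_fun h y);
    [|exists e => h; rewrite he].
have [ev hev] := choice mkev.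
have [|f hf] := @mk_linear _ N (HomMod (HomMod N C) C) ev.
  by move=> r u v; apply: hom_ext => h; rewrite hom_funP !hev hom_comb.
exists f; last by move=> y h; rewrite hf.
have hR := param_noeth Hx.
have HomReg (U : lmodType R) : regular (HomMod U C) x.
  move=> h xh; apply: hom_ext => u; apply: Creg.
  by rewrite -hom_funZ xh.
have N1 := fin_gen_hom hR Nfg Cfg.
have N2 := fin_gen_hom hR N1 Cfg.
apply: (bijective_mod_x Hx Nfg N2) => //.
- move=> y [k hk]; apply: contrapT => ny.
  have hB := is_sub_mulx (V := N) x.
  have [|g [hg _ ngy]] := cogenerator Nfg hB _ ny; first by move=> v; exists v.
  have [g' hg'] := lift_mod_x Hx Cfg Creg Cbaer Nfg Nreg hg.
  have [h hh] := mk_hom (@linear_comb _ _ _ g').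
  apply: ngy; apply: (is_subBl hxC _ (hg' y)).
  exists (hom_fun k h); rewrite -hom_funZ -hk hf hev.
  by rewrite hh.
- move=> xi.
  have [n [phi hphi]] := N1.
  pose G : lmodType R := {ffun 'I_n -> C}.
  have [|p hp] := @mk_linear _ N G (fun y => [ffun i => hom_fun (phi i) y]).
    by move=> r u v; apply/ffunP => i; rewrite !ffunE hom_comb.
  (* [B] collects the tuples of evaluations at elements of [N] modulo [x]; the tuple [g] below
     records [xi] on the generators. *)
  pose B (g : G) := exists y, mulx x (g - p y).
  have hxG := is_sub_mulx (V := G) x.
  have hB : is_sub B.
    split; first by exists 0; rewrite linear0 subr0; case: hxG.
    move=> r g g' [y hy] [y' hy']; exists (r *: y + y').
    by have := hxG.2 r _ _ hy hy'; rewrite linear_comb; congr mulx; lmod.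
  have Bv v : B (x *: v) by exists 0; rewrite linear0 subr0; exists v.
  pose g : G := [ffun i => hom_fun xi (phi i)].
  have [[y [k hk]]|nBg] := pselect (B g).
    exists y; apply: (divide_hom Creg) => h; have [c ->] := hphi h.
    have hl := mk_linear (hom_lin (xi - f y)); have [l hl'] := hl.
    rewrite -hl' linear_sum; exists (\sum_i c i *: k i).
    rewrite scaler_sumr; apply: eq_bigr => i _; rewrite linearZ_LR hl'.
    have /ffunP/(_ i) := hk; rewrite !ffunE hp ffunE hom_funB hf hev => ->.
    by rewrite !scalerA mulrC.
  exfalso.
  have Gfg : fin_gen G by apply: fin_gen_ffun.
  have [th [hth thB nthg]] := cogenerator Gfg hB Bv nBg.
  have mkinj i : exists d :
    {linear C -> G}, forall c, d c = [ffun j => if j == i then c else 0].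
    have [|d hd] := @mk_linear _ C G (fun c => [ffun j => if j == i then c else 0]).
      move=> r u v; apply/ffunP => j; rewrite !ffunE; case: ifP => // _.
      by rewrite scaler0 addr0.
    by exists d.
  have [d hd] := choice mkinj.
  have mkr i : exists r, forall c, xC (th (d i c) - r *: c).
    by apply: endo_scalar => r u v _ _; rewrite linear_comb; apply: hth.
  have [r hr] := choice mkr.
  have thE w : xC (th w - \sum_i r i *: w i).
    have -> : w = \sum_i 1 *: d i (w i).
      apply/ffunP => j; rewrite sum_ffunE (bigD1 j) //= big1 ?addr0.
        by rewrite ffunE hd ffunE eqxx scale1r.
      by move=> i ij; rewrite ffunE hd ffunE eq_sym (negPf ij) scaler0.
    have h1 := linmod_sum (fun=> 1) (fun i => d i (w i)) hxC hth.
    apply: (is_sub_trans hxC h1).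
    rewrite -sumrB; apply: (big_ind xC); [by case: hxC|by move=> ? ?; apply: is_subD|].
    move=> i _; rewrite scale1r.
    have -> : (\sum_i0 1 *: d i0 (w i0)) i = w i.
      rewrite sum_ffunE (bigD1 i) //= big1 ?addr0.
        by rewrite ffunE hd ffunE eqxx scale1r.
      by move=> j ji; rewrite ffunE hd ffunE eq_sym (negPf ji) scaler0.
    exact: hr.
  have [psi hpsi] : mulx x (\sum_i r i *: phi i).
    apply: (divide_hom Creg) => y.
    have h1 : xC (th (p y)).
      by apply: thB; exists y; rewrite subrr; case: hxG.
    have := is_subBr hxC h1 (thE (p y)); congr xC.
    have [evy hevy] := mk_linear (hom_lin (ev y)).
    rewrite -[RHS]hev -hevy linear_sum; apply: eq_bigr => i _.
    by rewrite linearZ_LR hevy hev hp ffunE.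
  apply: nthg; apply: (is_subBl hxC _ (thE g)).
  have [l hl] := mk_linear (hom_lin xi).
  exists (hom_fun xi psi); rewrite -homZ -hpsi -hl linear_sum.
  by apply: eq_bigr => i _; rewrite linearZ_LR hl ffunE.
Qed.

End OneModule.

(** An identification of the socles extends modulo [x] in both directions, since both reductions are
    injective over R/x. The map that results from C to D/xD lifts to D, and bijectivity is tested
    modulo [x]. *)
Lemma dualizing_unique (C D : lmodType R) : dualizing m x C -> dualizing m x D ->
  lmod_iso C D.
Proof.
move=> HC HD.
have socmap (U V : lmodType R) : dualizing m x U -> dualizing m x V ->
  forall s t, ~ mulx x (s : U) -> (forall a, a \in m -> mulx x (a *: s)) ->
    ~ mulx x (t : V) -> (forall a, a \in m -> mulx x (a *: t)) ->
  exists f : U -> V, linmod (fun=> True) (mulx x) f /\ mulx x (f s - t).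
  move=> [Ufg Ureg _ _] [Vfg Vreg Vbaer _] s t ns ms nt mt.
  have hU := is_sub_mulx (V := U) x; have hV := is_sub_mulx (V := V) x.
  have [||g [hg g0 gs]] := @extend_one R U V (mulx x) (mulx x) (fun=> 0) s t hU hV.
  - by move=> a u v _ _; rewrite scaler0 addr0 subr0; case: hV.
  - move=> a Ba; have [am|am] := boolP (a \in m).
      by rewrite sub0r; apply: is_subN => //; apply: mt.
    by case: ns; apply: (unit_cancel Hx hU am Ba).
  have xl v : sum_sub (mulx x) (line s) (x *: v).
    by apply: sum_subl; [apply: is_sub_line|exists v].
  have [||f [hf fg]] := extend_full Vbaer Ufg (is_sub_sum hU (is_sub_line s)) _ hg.
  - exact: xl.
  - by move=> v; have := g0 (x *: v); rewrite subr0; apply; exists v.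
  exists f; split=> //; apply: is_sub_trans (gs) => //; apply: fg.
  by apply: sum_subr => //; exists 1; rewrite scale1r.
have [_ _ _ [s [ns ms _]]] := HC; have [_ _ _ [t [nt mt _]]] := HD.
have [f [hf fs]] := socmap _ _ HC HD s t ns ms nt mt.
have [g [hg gt]] := socmap _ _ HD HC t s nt mt ns ms.
(* a composite fixing the socle is multiplication by a unit *)
have comp (U V : lmodType R) (p : U -> V) (q : V -> U) (s' : U) (t' : V) :
  dualizing m x U -> ~ mulx x s' -> (forall a, a \in m -> mulx x (a *: s')) ->
  linmod (fun=> True) (mulx x) p -> linmod (fun=> True) (mulx x) q ->
  mulx x (p s' - t') -> mulx x (q t' - s') ->
  exists b, forall u, mulx x (u - b *: q (p u)).
  move=> HU ns' ms' hp hq ps qt.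
  have hU := is_sub_mulx (V := U) x; have hV := is_sub_mulx (V := V) x.
  have qx v : mulx x v -> mulx x (q v).
    by move=> [k ->]; apply: linmod_mulx.
  have qB v w : mulx x (v - w) -> mulx x (q v - q w).
    by move=> /qx; apply: (linmod_congr (is_sub_full V) hU hq).
  have [|r hr] := endo_scalar HU (f := q \o p).
    move=> a u v _ _ /=.
    have h1 := qB _ _ (hp a u v I I); have h2 := hq a (p u) (p v) I I.
    exact: (is_sub_trans hU h1 h2).
  have h1 := is_sub_trans hU (qB _ _ ps) qt.
  have h2 := is_subB hU h1 (hr s').
  have [rm|/(param_unit Hx) [b br]] := boolP (r \in m).
    case: ns'; have := is_subB hU (ms' _ rm) h2.
    by congr mulx; rewrite /=; lmod.
  exists b => u; have := is_subZ (- b) hU (hr u); rewrite /=.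
  rewrite -[X in _ -> mulx x (X - _)]scale1r -br.
  by congr mulx; lmod.
have [b hb] := comp _ _ f g s t HC ns ms hf hg fs gt.
have [c hc] := comp _ _ g f t s HD nt mt hg hf gt fs.
have [Cfg Creg _ _] := HC; have [Dfg Dreg Dbaer _] := HD.
have [F hF] := lift_mod_x Hx Dfg Dreg Dbaer Cfg Creg hf.
have hxC := is_sub_mulx (V := C) x; have hxD := is_sub_mulx (V := D) x.
exists F; apply: (bijective_mod_x Hx Cfg Dfg Dreg).
- move=> u Fu; have fu := is_subBl hxD Fu (hF u).
  apply: (is_subBl hxC _ (hb u)); apply: is_subZ => //.
  by case: fu => k ->; apply: linmod_mulx.
- move=> v; exists (c *: g v); rewrite linearZ_LR.
  have := is_subD hxD (hc v) (is_subZ c hxD (hF (g v))).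
  by congr mulx; lmod.
Qed.

End Duality.

(** * Coinduced modules over the idealization *)

Section Coinduced.
Variables (R : comNzRingType) (M : lmodType R).
Local Notation A := (idealization M).
Local Notation sc := (@idl_scal R M).
Local Notation ve := (@idl_vec R M).

Lemma idl_split (z : A) : z = sc z.1 + ve z.2.
Proof. by case: z => r p; rewrite -[RHS]/(r + 0, 0 + p) addr0 add0r. Qed.

Lemma idl_scal_vec r p : sc r * ve p = ve (r *: p).
Proof. by rewrite idl_vecZ. Qed.

Lemma idl_vec_vec p q : ve p * ve q = 0.
Proof. by rewrite -[LHS]/(0 * 0, 0 *: q + 0 *: p) mulr0 !scale0r addr0. Qed.

(* Hom_R(A, E) as an A-module: phi corresponds to (phi (1, 0), phi (0, -)). *)
Definition coind (E : lmodType R) : Type := (E * HomMod M E)%type.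
HB.instance Definition _ (E : lmodType R) := GRing.Zmodule.on (coind E).

Definition coind_scale (E : lmodType R) (z : A) (u : coind E) : coind E :=
  (z.1 *: u.1 + hom_fun u.2 z.2, z.1 *: u.2).

Fact coind_scaleA (E : lmodType R) z w (u : coind E) :
  coind_scale z (coind_scale w u) = coind_scale (z * w) u.
Proof.
congr pair; last exact: scalerA.
rewrite -[hom_fun (coind_scale w u).2 z.2]/(w.1 *: hom_fun u.2 z.2) /=.
by rewrite homD !homZ; lmod.
Qed.

Fact coind_scale1 (E : lmodType R) : left_id 1 (@coind_scale E).
Proof.
move=> [e h]; congr pair; last exact: scale1r.
by rewrite -[LHS]/(1 *: e + hom_fun h 0) hom0 addr0 scale1r.
Qed.

Fact coind_scaleDr (E : lmodType R) : right_distributive (@coind_scale E) +%R.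
Proof.
move=> z [e h] [e' h']; congr pair; last exact: scalerDr.
rewrite -[LHS]/(z.1 *: (e + e') + (hom_fun h z.2 + hom_fun h' z.2)).
rewrite -[RHS]/((z.1 *: e + hom_fun h z.2) + (z.1 *: e' + hom_fun h' z.2)).
by lmod.
Qed.

Fact coind_scaleDl (E : lmodType R) (u : coind E) :
  {morph (@coind_scale E)^~ u : z w / z + w}.
Proof.
move=> z w; congr pair; last exact: scalerDl.
rewrite -[LHS]/((z.1 + w.1) *: u.1 + hom_fun u.2 (z.2 + w.2)).
rewrite -[RHS]/((z.1 *: u.1 + hom_fun u.2 z.2) + (w.1 *: u.1 + hom_fun u.2 w.2)).
by rewrite homD; lmod.
Qed.

HB.instance Definition _ (E : lmodType R) :=
  GRing.Zmodule_isLmodule.Build A (coind E)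
    (@coind_scaleA E) (@coind_scale1 E) (@coind_scaleDr E) (@coind_scaleDl E).

Lemma coindE (E : lmodType R) (z : A) (e : E) (h : HomMod M E) :
  z *: ((e, h) : coind E) = (z.1 *: e + hom_fun h z.2, z.1 *: h).
Proof. by []. Qed.

Lemma coind_addE (E : lmodType R) (e e' : E) (h h' : HomMod M E) :
  ((e, h) : coind E) + (e', h') = (e + e', h + h').
Proof. by []. Qed.

Fact hom_comp_subproof (E F : lmodType R) (d : {linear E -> F}) (h : HomMod M E) :
  (fun p => d (hom_fun h p)) \in @linear_pred R M F.
Proof. by apply/asboolP => r u v; rewrite hom_comb linear_comb. Qed.

Definition hom_comp (E F : lmodType R) (d : {linear E -> F}) (h : HomMod M E) :
  HomMod M F := Submod (hom_comp_subproof d h).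

Lemma hom_compE (E F : lmodType R) (d : {linear E -> F}) (h : HomMod M E) p :
  hom_fun (hom_comp d h) p = d (hom_fun h p).
Proof. by []. Qed.

Definition coind_map (E F : lmodType R) (d : {linear E -> F}) (u : coind E) : coind F :=
  (d u.1, hom_comp d u.2).

Fact coind_map_linear (E F : lmodType R) (d : {linear E -> F}) : linear (coind_map d).
Proof.
move=> z [e h] [e' h']; congr pair.
  rewrite -[LHS]/(d (z.1 *: e + hom_fun h z.2 + e')).
  rewrite -[RHS]/(z.1 *: d e + d (hom_fun h z.2) + d e').
  by rewrite !linearD linearZ_LR.
apply: hom_ext => p; rewrite -[LHS]/(d (z.1 *: hom_fun h p + hom_fun h' p)).
by rewrite linear_comb.
Qed.

HB.instance Definition _ (E F : lmodType R) (d : {linear E -> F}) :=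
  GRing.isLinear.Build A (coind E) (coind F) *:%R (coind_map d) (coind_map_linear d).

(** Restriction of scalars from A to R. The alias keeps the two module structures on one additive
    group apart. *)
Definition restr (P : lmodType A) : Type := P.
HB.instance Definition _ (P : lmodType A) := GRing.Zmodule.on (restr P).

Definition restr_scale (P : lmodType A) (r : R) (u : restr P) : restr P :=
  sc r *: (u : P).

Fact restr_scaleA (P : lmodType A) r s (u : restr P) :
  restr_scale r (restr_scale s u) = restr_scale (r * s) u.
Proof. by rewrite /restr_scale scalerA idl_scalM. Qed.

Fact restr_scale1 (P : lmodType A) : left_id 1 (@restr_scale P).
Proof. by move=> u; apply: scale1r. Qed.

Fact restr_scaleDr (P : lmodType A) : right_distributive (@restr_scale P) +%R.
Proof. by move=> r u v; apply: scalerDr. Qed.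

Fact restr_scaleDl (P : lmodType A) (u : restr P) :
  {morph (@restr_scale P)^~ u : r s / r + s}.
Proof. by move=> r s; rewrite /restr_scale idl_scalD; apply: scalerDl. Qed.

HB.instance Definition _ (P : lmodType A) :=
  GRing.Zmodule_isLmodule.Build R (restr P)
    (@restr_scaleA P) (@restr_scale1 P) (@restr_scaleDr P) (@restr_scaleDl P).

Lemma restrE (P : lmodType A) r (u : P) : r *: (u : restr P) = sc r *: u.
Proof. by []. Qed.

(** Coinduction is right adjoint to restriction of scalars, and restriction preserves injective
    maps. *)
Lemma coind_injective (E : lmodType R) : injective_module E ->
  injective_module (coind E).
Proof.
move=> hE P Q i f iinj.
have [|f1 hf1] := @mk_linear R (restr P) E (fun u => (f (u : P)).1).
  move=> r u v; rewrite restrE [f _]linear_comb.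
  by case: (f u) => e h; rewrite coindE /= hom0 addr0.
have [|i1 hi1] := @mk_linear R (restr P) (restr Q) (i : P -> Q).
  by move=> r u v; rewrite restrE [i _]linear_comb.
have [|g0 hg0] := @hE _ _ i1 f1.
  by move=> u v; rewrite !hi1; apply: iinj.
(* The adjoint of [g0] takes q to the map z -> g0 (z q) on A; this is its part on the vectors
   [ve p]. *)
have hom q : exists h : HomMod M E, forall p, hom_fun h p = g0 (ve p *: (q : Q)).
  have [|h hh] := @mk_hom R M E (fun p => g0 (ve p *: (q : Q)));
    last by exists h => p; rewrite hh.
  move=> r p p'; rewrite -linear_comb; congr (g0 _).
  by rewrite restrE idl_vecD idl_vecZ scalerDl scalerA.
have [H hH] := choice hom.
have [|g hg] := @mk_linear A Q (coind E) (fun q => (g0 (q : restr Q), H q)).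
  move=> z q q'; rewrite coindE coind_addE; congr pair.
    rewrite hH -linear_comb -linearD; congr (g0 _).
    rewrite restrE {1}[z]idl_split scalerDl; by [].
  apply: hom_ext => p; rewrite hom_funP !hH -linear_comb; congr (g0 _).
  transitivity (sc z.1 *: (ve p *: q) + ve p *: q'); last by [].
  rewrite scalerDr !scalerA {1}[z]idl_split mulrDr idl_vec_vec addr0.
  by rewrite [ve p * sc _]mulrC.
exists g => u; rewrite hg [f u]surjective_pairing; congr pair.
  by have := hg0 u; rewrite hi1 hf1.
apply: hom_ext => p; rewrite hH -linearZ_LR.
have := hg0 (ve p *: u); rewrite hi1 hf1 => ->.
by rewrite linearZ_LR {1}[f u]surjective_pairing coindE /= scale0r add0r.
Qed.

End Coinduced.

(** * The idealization as a one-dimensional local ring, and its canonical module *)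

Section IdealizationRing.
Variables (R : comNzRingType) (M : lmodType R).
Local Notation A := (idealization M).
Local Notation sc := (@idl_scal R M).
Local Notation ve := (@idl_vec R M).

Lemma is_sub_restr (P : lmodType A) (U : P -> Prop) : is_sub U ->
  is_sub (U : restr P -> Prop).
Proof. by move=> [U0 US]; split=> // r u v; apply: (US (sc r)). Qed.

Lemma span_restr (P : lmodType A) (s : seq P) (v : P) :
  spanned (s : seq (restr P)) v -> spanned s v.
Proof.
elim: s v => [|y s IH] v //= [r [w [hw ->]]].
by exists (sc r), w; split; [apply: IH|].
Qed.

Lemma fg_restr (P : lmodType A) (U : P -> Prop) : is_sub U ->
  fg (U : restr P -> Prop) -> fg U.
Proof.
move=> hU hs; have [s [h1 h2]] := fg_seq (is_sub_restr hU) hs.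
exists s => v; split; first by move=> /h2; apply: span_restr.
exact: (span_sub hU).
Qed.

Lemma idl_fg_restr : fin_gen M -> fin_gen (restr (A^o : lmodType A)).
Proof.
move=> /fin_genP [s hs]; apply/fin_genP.
pose t : seq (restr (A^o : lmodType A)) := (1 : A) :: map ve s.
exists t => -[r p]; exists r, (ve p : A); split; last first.
  rewrite restrE /GRing.scale /= mulr1.
  by rewrite -[RHS]/(r + 0, 0 + p) addr0 add0r.
apply: (span_sub (U := fun p => spanned (map ve s : seq (restr (A^o :
  lmodType A))) (ve p)) _ _ (hs p)).
  have [h0 hS] := is_sub_span (map ve s : seq (restr (A^o : lmodType A))).
  by split=> // a u v hu hv; rewrite idl_vecD idl_vecZ; apply: (hS a).
by move=> v hv; apply: span_mem; apply: map_f.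
Qed.

(** An ideal of A is an R-submodule of A, which is finitely generated over R. *)
Lemma idl_noeth : noeth R -> fin_gen M -> noeth A.
Proof.
move=> hR hM a ha; apply: fg_restr => //.
by apply: (sub_fg hR (idl_fg_restr hM)); apply: is_sub_restr.
Qed.

Lemma idl_mulE (z w : A) : z * w = (z.1 * w.1, z.1 *: w.2 + w.1 *: z.2).
Proof. by []. Qed.

Lemma prime_vec (p : A^o -> Prop) v : is_sub p ->
  (forall a b, p (a * b) -> p a \/ p b) -> p (ve v).
Proof.
move=> hp pM; have : p (ve v * ve v) by rewrite idl_vec_vec; case: hp.
by case/pM.
Qed.

Lemma sub_scal (p : A^o -> Prop) : is_sub p -> is_sub (fun r : R^o => p (sc r)).
Proof.
move=> [p0 pS]; split=> // r u v hu hv.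
by rewrite idl_scalD idl_scalM; apply: (pS (sc r)).
Qed.

Lemma prime_idealr_sub (S : comNzRingType) (q : prime_idealr S) :
  is_sub (fun r : S^o => r \in q).
Proof.
split; first exact: (idealr0 q).
move=> r u v hu hv; have := rpredD (idealMr r hu) hv; exact.
Qed.

(** Vectors square to zero, so every prime of A contains 0 x M. The primes of A are therefore the p
    x M with p a prime of R. *)
Lemma idl_prime_chain d : prime_chain R d <-> prime_chain A d.
Proof.
split=> -[p hp].
  have mkq i : exists q : prime_idealr A, forall z, (z \in q) <-> (z.1 \in p i).
    have [p0 pS] := prime_idealr_sub (p i).
    apply: (@sub_prime A (fun z : A => z.1 \in p i)).
    - by split=> // r u v; apply: pS.
    - by rewrite (idealr1 (p i)).
    - by move=> a b; rewrite (prime_idealrM (p i)) => /orP.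
  have [q hq] := choice mkq; exists q => i /hp [h1 [r h2 h3]]; split.
    by move=> z /hq hz; apply/hq/h1.
  by exists (sc r); [apply/hq|apply/negP => /hq; apply/negP].
have mkq i : exists q : prime_idealr R, forall r, (r \in q) <-> (sc r \in p i).
  apply: (@sub_prime R (fun r => sc r \in p i)).
  - exact: (sub_scal (prime_idealr_sub (p i))).
  - by rewrite -[sc 1]/(1 : A) (idealr1 (p i)).
  - by move=> a b; rewrite idl_scalM (prime_idealrM (p i)) => /orP.
have [q hq] := choice mkq; exists q => i /hp [h1 [z h2 h3]]; split.
  by move=> r /hq hr; apply/hq/h1.
have hv j : ve z.2 \in p j.
  apply: (prime_vec _ (prime_idealr_sub (p j))) => a b.
  by rewrite (prime_idealrM (p j)) => /orP.
exists z.1.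
  apply/hq; have := is_subB (prime_idealr_sub (p i.+1)) h2 (hv i.+1).
  by rewrite {1}[z]idl_split addrK.
apply/negP => /hq hz; case/negP: h3; rewrite [z]idl_split.
exact: (is_subD (prime_idealr_sub (p i)) hz (hv i)).
Qed.

Lemma idl_krull_dim d : krull_dim R d -> krull_dim A d.
Proof.
move=> [h1 h2]; split; first exact/idl_prime_chain.
by move=> /idl_prime_chain.
Qed.

Variables (m : ideal R) (x : R).
Hypothesis Hx : local_param m x.
Hypotheses (Mfg : fin_gen M) (Mreg : regular M x).
Variable n : ideal A.
Hypothesis hn : forall z : A, (z \in n) = (z.1 \in m).

Lemma idl_unit (z : A) : z \notin n -> exists w, w * z = 1.
Proof.
rewrite hn => /(param_unit Hx) [b hb].
(* If b is the inverse of r, then (r, v) has inverse (b, - b^2 v). *)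
exists (b, - (b * b) *: z.2); rewrite idl_mulE /= hb; congr pair.
rewrite scalerA -scalerDl.
have -> : b + z.1 * - (b * b) = 0; last by rewrite scale0r.
have -> : z.1 * - (b * b) = - ((b * z.1) * b) by ring.
by rewrite hb mul1r subrr.
Qed.

Lemma idl_local_param : local_param n (sc x).
Proof.
split.
- exact: idl_noeth (param_noeth Hx) Mfg.
- by rewrite hn (param1 Hx).
- exact: idl_unit.
- split; first by rewrite hn (param_mem Hx).
  move=> [a p]; rewrite idl_mulE /= scaler0 addr0 => -[/(param_reg Hx) -> /Mreg ->].
  by [].
- move=> p hp p1 pM px z; rewrite hn => zm; rewrite [z]idl_split.
  apply: (is_subD hp); last exact: prime_vec.
  case: Hx => _ _ _ _ hprime; apply: (hprime (fun r => p (sc r))) => //.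
    exact: sub_scal.
  by move=> a b; rewrite idl_scalM; apply: pM.
Qed.

Lemma idl_local_ring : local_ring n.
Proof.
have h1 : 1 \notin n by rewrite hn (param1 Hx).
have hle (J : ideal A) : 1 \notin J -> {subset J <= n}.
  by move=> J1 z; apply: (proper_sub_maximal idl_unit (is_sub_closed J) (negP J1)).
split.
  split=> // J nJ J1 z; apply/idP/idP; [exact: hle|exact: nJ].
move=> n' [n'1 hmax] z; have := hmax n (hle n' n'1) h1 z; exact: esym.
Qed.

Section CoindCanonical.
Variable C : lmodType R.
Hypothesis HC : dualizing m x C.
Let Cfg : fin_gen C. Proof. by case: HC. Qed.
Let Creg : regular C x. Proof. by case: HC. Qed.
Let Cbaer : baer x (@mulx R C x). Proof. by case: HC. Qed.
Let Csoc : simple_socle m x C. Proof. by case: HC. Qed.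

Lemma coind_fin_gen : fin_gen (coind M C).
Proof.
have /fin_genP [sH hsH] := fin_gen_hom (param_noeth Hx) Mfg Cfg.
have /fin_genP [sC hsC] := Cfg.
pose iC (c : C) : coind M C := (c, 0); pose iH (h : HomMod M C) : coind M C := (0, h).
pose t := map iC sC ++ map iH sH; have hT := is_sub_span t.
have key (V : lmodType R) (i : V -> coind M C) (s : seq V) v :
    (forall r u v, i (r *: u + v) = sc r *: i u + i v) -> i 0 = 0 ->
    (forall u, u \in s -> i u \in t) -> spanned s v -> spanned t (i v).
  move=> ilin i0 ht; apply: (span_sub (U := fun v => spanned t (i v))).
    by split=> [|r u w hu hw]; [rewrite i0; case: hT|rewrite ilin; apply: hT.2].
  by move=> u /ht; apply: span_mem.
apply/fin_genP; exists t => -[c h].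
have -> : (c, h) = iC c + iH h by rewrite coind_addE addr0 add0r.
apply: (is_subD hT).
  apply: (key _ iC sC) => // [r u v|u hu].
    rewrite /iC coindE coind_addE; congr pair; last by rewrite scaler0 addr0.
    by rewrite -[hom_fun _ _]/(0 : C) addr0.
  by rewrite mem_cat map_f.
apply: (key _ iH sH) => // [r u v|u hu].
  rewrite /iH coindE coind_addE; congr pair.
  by rewrite hom0 scaler0 !addr0.
by rewrite mem_cat map_f ?orbT.
Qed.

Lemma coind_regular : regular (coind M C) (sc x).
Proof.
move=> [c h] hz; congr pair.
  by have := congr1 (@fst _ _) hz; rewrite /= hom0 addr0 => /Creg.
apply: hom_ext => p; apply: Creg.
by have := congr1 (fun u : coind M C => hom_fun u.2 p) hz.
Qed.

(** If (c, h) is a socle element modulo [x], multiplying it by [ve p] puts each h(p) in xC, so h is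
    divisible by [x]. It remains that c is a socle element of C/xC. *)
Lemma coind_socle : simple_socle n (sc x) (coind M C).
Proof.
have [s [ns ms gen]] := Csoc.
exists ((s, 0) : coind M C); split.
- move=> [[c h]]; rewrite coindE /= hom0 addr0 => -[hs _].
  by apply: ns; exists c.
- move=> z; rewrite hn => /ms [c hc]; exists ((c, 0) : coind M C).
  rewrite !coindE; congr pair; last by rewrite !scaler0.
  by rewrite -[LHS]/(z.1 *: s + 0) -[RHS]/(x *: c + 0) hc.
- move=> [c h] hz.
  have [h' hh'] : mulx x h.
    apply: (divide_hom Creg) => p; have [|[e' h'']] := hz (ve p).
      by rewrite hn; apply: rpred0.
    by rewrite !coindE /= hom0 scale0r add0r addr0 => -[-> _]; exists e'.
  have [|r [k hk]] := gen c.
    move=> a am; have [|[e' h'']] := hz (sc a); first by rewrite hn.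
    by rewrite !coindE /= !hom0 !addr0 => -[-> _]; exists e'.
  exists (sc r), ((k, h') : coind M C).
  congr pair; last by rewrite hh' -[LHS]/(x *: h' - r *: 0) scaler0 subr0.
  rewrite -[LHS]/(c - (r *: s + 0)) -[RHS]/(x *: k + hom_fun h' 0).
  by rewrite hom0 !addr0.
Qed.

Lemma coind_map_inj (E F : lmodType R) (d : {linear E -> F}) :
  injective d -> injective (coind_map (M := M) d).
Proof.
move=> dinj [c h] [c' h'] e; congr pair.
  by have /= /dinj := congr1 (@fst _ _) e.
apply: hom_ext => p; apply: dinj.
by have := congr1 (fun u : coind M F => hom_fun u.2 p) e.
Qed.

Section CoindResolution.
Variable E : inj_resolution C.

Lemma coind_res_exact0 (u : coind M (E 0)) :
  coind_map (res_d E 0) u = 0 <-> exists v, coind_map (res_aug E) v = u.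
Proof.
case: u => e h; split=> [hz|[[c h'] <-]]; last first.
  by congr pair; [apply: res_d_aug|apply: hom_ext => p; apply: res_d_aug].
have /= /res_exact0 [c hc] := congr1 (@fst _ _) hz.
have e2 p : res_d E 0 (hom_fun h p) = 0.
  by have := congr1 (fun u : coind M (E 1) => hom_fun u.2 p) hz.
have [q hq] := choice (fun p => (res_exact0 (hom_fun h p)).1 (e2 p)).
have [|h' hh'] := @mk_hom R M C q.
  move=> r u v; apply: (@res_aug_inj _ _ E).
  by rewrite linear_comb !hq hom_comb.
exists ((c, h') : coind M C); congr pair => //.
by apply: hom_ext => p; rewrite hom_compE /= hh'.
Qed.

(** Lifting a map from M into the cycles is the vanishing of Ext^(i+1)(M, C), supplied by
    [lift_cycle]; in degree zero left exactness of Hom was enough. *)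
Lemma coind_res_exactS i (u : coind M (E i.+1)) :
  coind_map (res_d E i.+1) u = 0 <-> exists v, coind_map (res_d E i) v = u.
Proof.
case: u => e h; split=> [hz|[[c h'] <-]]; last first.
  by congr pair; [apply: res_dd|apply: hom_ext => p; apply: res_dd].
have /= /res_exactS [c hc] := congr1 (@fst _ _) hz.
have e2 p : res_d E i.+1 (hom_fun h p) = 0.
  by have := congr1 (fun u : coind M (E i.+2) => hom_fun u.2 p) hz.
have [f hf] := mk_linear (hom_lin h).
have [|g hg] := lift_cycle Hx Cfg Creg Cbaer (f := f) Mfg Mreg.
  by move=> p; rewrite hf.
have [h' hh'] := mk_hom (@linear_comb _ _ _ g).
exists ((c, h') : coind M (E i)); congr pair => //.
by apply: hom_ext => p; rewrite hom_compE /= hh' hg hf.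
Qed.

Definition coind_res : inj_resolution (coind M C) :=
  @InjResolution A (coind M C) (fun i => coind M (E i))
    (coind_map (res_aug E)) (fun i => coind_map (res_d E i))
    (fun i => coind_injective (@res_inj _ _ E i))
    (coind_map_inj (@res_aug_inj _ _ E)) coind_res_exact0 coind_res_exactS.

End CoindResolution.

Lemma coind_finite_inj_dim : finite_inj_dim C -> finite_inj_dim (coind M C).
Proof.
move=> [E [N hN]].
apply: (ex_intro _ (coind_res E)); exists N => i hi [e h].
congr pair; first exact: hN.
by apply: hom_ext => p; apply: (hN i hi).
Qed.

Lemma coind_canonical : krull_dim R 1 -> finite_inj_dim C ->
  canonical_module n (coind M C).
Proof.
move=> hdim hC; have HA := idl_local_param.
have hd := dualizing_depth HA coind_regular coind_socle.
split; last exact: coind_finite_inj_dim.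
  split; first exact: coind_fin_gen.
  by exists 1%N => //; apply: idl_krull_dim.
have [E _] := hC; exists 1%N, (coind_res E); split=> //.
by apply/(ext1_socle HA (coind_res E) coind_regular)/coind_socle.
Qed.

End CoindCanonical.
End IdealizationRing.

(** * Products and powers of ideals, and reductions *)

Section IdealMul.
Variable R : comNzRingType.
Implicit Types (I J : {pred R}).

Lemma ideal_mulP I J y : reflect (exists s : seq (R * R),
    {in s, forall p, p.1 \in I /\ p.2 \in J} /\ y = \sum_(p <- s) p.1 * p.2)
  (y \in ideal_mul I J).
Proof. exact: asboolP. Qed.

Lemma ideal_mul_ind I J (P : R -> Prop) : P 0 ->
  (forall a b, P a -> P b -> P (a + b)) ->
  (forall a b, a \in I -> b \in J -> P (a * b)) ->
  forall y, y \in ideal_mul I J -> P y.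
Proof.
move=> P0 PD PM y /ideal_mulP [s [hs ->]].
rewrite big_seq; apply: (big_ind P) => // p /hs [h1 h2]; exact: PM.
Qed.

Lemma ideal_mul0 I J : 0 \in ideal_mul I J.
Proof. by apply/ideal_mulP; exists [::]; rewrite big_nil. Qed.

Lemma ideal_mulD I J a b : a \in ideal_mul I J -> b \in ideal_mul I J ->
  a + b \in ideal_mul I J.
Proof.
move=> /ideal_mulP [s [hs ->]] /ideal_mulP [t [ht ->]].
apply/ideal_mulP; exists (s ++ t); rewrite big_cat; split=> // p.
by rewrite mem_cat => /orP [/hs|/ht].
Qed.

Lemma ideal_mul_mem I J a b : a \in I -> b \in J -> a * b \in ideal_mul I J.
Proof.
move=> ha hb; apply/ideal_mulP; exists [:: (a, b)]; rewrite big_seq1; split=> // p.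
by rewrite inE => /eqP ->.
Qed.

Lemma ideal_mul_sub I I' J : {subset I <= I'} ->
  {subset ideal_mul I J <= ideal_mul I' J}.
Proof.
move=> h; apply: ideal_mul_ind; first exact: ideal_mul0.
- by move=> a b; apply: ideal_mulD.
- by move=> a b /h ha hb; apply: ideal_mul_mem.
Qed.

Lemma ideal_exp_pow (I : {pred R}) a k : a \in I -> a ^+ k \in ideal_exp I k.
Proof. by move=> ha; elim: k => //= k IH; rewrite exprS; apply: ideal_mul_mem. Qed.

Lemma ideal_mul_subl (I : ideal R) (J : {pred R}) : {subset ideal_mul I J <= I}.
Proof.
apply: ideal_mul_ind; first exact: rpred0.
- by move=> a b; apply: rpredD.
- by move=> a b ha _; rewrite mulrC; apply: (rpredZ b).
Qed.

Lemma reduction_pow (I m : ideal R) a : reduction I m -> a \in m ->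
  exists k, a ^+ k \in I.
Proof.
move=> [_ [k hk]] /(ideal_exp_pow k.+1); rewrite hk => h.
by exists k.+1; apply: ideal_mul_subl h.
Qed.

End IdealMul.

Section IdealizationReduction.
Variables (R : comNzRingType) (M : lmodType R).
Local Notation A := (idealization M).
Local Notation sc := (@idl_scal R M).
Local Notation ve := (@idl_vec R M).
Variables (m : ideal R) (n : ideal A).
Hypothesis hn : forall z : A, (z \in n) = (z.1 \in m).

Lemma ideal_exp_scal k r : r \in ideal_exp m k -> sc r \in ideal_exp n k.
Proof.
elim: k r => // k IH.
apply: (ideal_mul_ind (P := fun r => sc r \in ideal_exp n k.+1)).
- exact: ideal_mul0.
- by move=> a b ha hb; rewrite idl_scalD; apply: ideal_mulD.
- by move=> a b ha hb; rewrite idl_scalM; apply: ideal_mul_mem; [rewrite hn|apply: IH].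
Qed.

Lemma ideal_exp_fst k (z : A) : z \in ideal_exp n k -> z.1 \in ideal_exp m k.
Proof.
elim: k z => // k IH.
apply: (ideal_mul_ind (P := fun z : A => z.1 \in ideal_exp m k.+1)).
- exact: ideal_mul0.
- by move=> a b; apply: ideal_mulD.
- by move=> a b; rewrite hn => ha /IH; apply: ideal_mul_mem.
Qed.

Variables (I : ideal R) (L : submodClosed M) (J : ideal A).
Hypothesis hJ : forall z : A, (z \in J) = (z.1 \in I) && (z.2 \in L).

Lemma scal_mem a : a \in I -> sc a \in J.
Proof. by move=> ha; rewrite hJ ha rpred0. Qed.

Lemma reduction_descend : reduction J n -> reduction I m.
Proof.
move=> [Jn [k hk]].
have Im : {subset I <= m} by move=> a /scal_mem /Jn; rewrite hn.
split=> //; exists k => r; apply/idP/idP; last exact: ideal_mul_sub.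
move=> /ideal_exp_scal; rewrite hk.
apply: (ideal_mul_ind (P := fun z : A => z.1 \in ideal_mul I (ideal_exp m k))).
- exact: ideal_mul0.
- by move=> a b; apply: ideal_mulD.
- by move=> a b; rewrite hJ => /andP [ha _] /ideal_exp_fst; apply: ideal_mul_mem.
Qed.

(** In a product of k + 1 elements of [n], each term of the second component takes its vector from
    one factor and scalars in [m] from the k others. *)
Lemma ideal_exp_snd k (z : A) : z \in ideal_exp n k.+1 ->
  exists s : seq (R * M), {in s, forall p, p.1 \in ideal_exp m k} /\
    z.2 = \sum_(p <- s) p.1 *: p.2.
Proof.
pose P k (v : M) := exists s : seq (R * M), {in s, forall p, p.1 \in ideal_exp m k} /\
    v = \sum_(p <- s) p.1 *: p.2.
have P0 j : P j 0 by exists [::]; rewrite big_nil.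
have PD j u v : P j u -> P j v -> P j (u + v).
  move=> [s [hs ->]] [t [ht ->]]; exists (s ++ t); rewrite big_cat; split=> // p.
  by rewrite mem_cat => /orP [/hs|/ht].
have P1 j r v : r \in ideal_exp m j -> P j (r *: v).
  move=> hr; exists [:: (r, v)]; rewrite big_seq1; split=> // p.
  by rewrite inE => /eqP ->.
elim: k z => [|k IH] z; first by move=> _; exists [:: (1, z.2)];
  rewrite big_seq1 scale1r.
move: z; apply: (ideal_mul_ind (P := fun z : A => P k.+1 z.2)) => //.
  by move=> a b; apply: PD.
move=> a b ha hb; rewrite idl_mulE /=; apply: (PD); last exact/P1/ideal_exp_fst.
have [s [hs ->]] := IH _ hb; rewrite scaler_sumr big_seq.
apply: (big_ind (P k.+1)) => // [u v|p /hs hp]; first exact: PD.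
by rewrite scalerA; apply: P1; apply: ideal_mul_mem; rewrite -?hn.
Qed.

Lemma reduction_lift : reduction I m -> reduction J n.
Proof.
move=> [Im [k hk]].
have Jn : {subset J <= n} by move=> z; rewrite hJ hn => /andP [/Im].
(* The exponent rises by one. Second components of n^(k+2) lie in m^(k+1) M = I m^k M, and 0 x m^k M
   is contained in n^(k+1). *)
split=> //; exists k.+1 => z; apply/idP/idP; last exact: ideal_mul_sub.
set X := ideal_mul J (ideal_exp n k.+1).
have hX (a : R) (w : A) : a \in I -> w \in ideal_exp n k.+1 -> sc a * w \in X.
  by move=> ha; apply: ideal_mul_mem; apply: scal_mem.
move=> hz; rewrite [z]idl_split; apply: ideal_mulD.
  have : z.1 \in ideal_mul I (ideal_exp m k.+1).
    move: (ideal_exp_fst hz).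
    apply: (ideal_mul_ind (P := fun r => r \in ideal_mul I (ideal_exp m k.+1))).
    - exact: ideal_mul0.
    - by move=> a b; apply: ideal_mulD.
    move=> a b ha; rewrite hk.
    apply: (ideal_mul_ind (P := fun b => a * b \in ideal_mul I (ideal_exp m k.+1))).
    - by rewrite mulr0; apply: ideal_mul0.
    - by move=> c d h1 h2; rewrite mulrDr; apply: ideal_mulD.
    by move=> c d hc hd; rewrite mulrCA; do 2!apply: ideal_mul_mem => //.
  apply: (ideal_mul_ind (P := fun r => sc r \in X)).
  - exact: ideal_mul0.
  - by move=> a b h1 h2; rewrite idl_scalD; apply: ideal_mulD.
  - by move=> a b ha /ideal_exp_scal hb; rewrite idl_scalM; apply: hX.
have [s [hs ->]] := ideal_exp_snd hz; rewrite big_seq.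
apply: (big_ind (fun v => ve v \in X)).
- exact: ideal_mul0.
- by move=> u v h1 h2; rewrite idl_vecD; apply: ideal_mulD.
move=> p /hs; rewrite hk.
apply: (ideal_mul_ind (P := fun r => ve (r *: p.2) \in X)).
- by rewrite scale0r; apply: ideal_mul0.
- by move=> u v h1 h2; rewrite scalerDl idl_vecD; apply: ideal_mulD.
move=> a b ha hb; rewrite -scalerA idl_vecZ; apply: hX => //.
rewrite idl_vecZ mulrC; apply: ideal_mul_mem; last exact: ideal_exp_scal.
by rewrite hn; apply: rpred0.
Qed.

End IdealizationReduction.

(** * Perfect pairings *)

Section Pairing.
Variables (R : comNzRingType) (m : ideal R) (x : R).
Hypothesis Hx : local_param m x.
Variables (C : lmodType R) (HC : dualizing m x C).

Lemma linear_bijective (U V : lmodType R) (f : {linear U -> V}) :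
  (forall u, f u = 0 -> u = 0) -> (forall v, exists u, f u = v) -> bijective f.
Proof.
move=> finj fsurj; have [g hg] := choice fsurj; exists g => // u.
by apply/subr0_eq/finj; rewrite linearB /= hg subrr.
Qed.

(** A pairing of U and V into C that is perfect on one side is perfect on the other, because [V] is
    reflexive and [b] identifies [U] with its dual. *)
Lemma dual_swap (U V : lmodType R) (b : {linear U -> HomMod V C}) :
  fin_gen V -> regular V x -> bijective b ->
  exists2 g : {linear V -> HomMod U C}, bijective g &
    forall u v, hom_fun (g v) u = hom_fun (b u) v.
Proof.
move=> Vfg Vreg [b' b1 b2].
have [f [f' f1 f2] hf] := reflexive Hx HC Vfg Vreg.
have mk v : exists h : HomMod U C, forall u, hom_fun h u = hom_fun (b u) v.
  have [|h hh] := @mk_hom R U C (fun u => hom_fun (b u) v);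
    last by exists h => u; rewrite hh.
  by move=> r u w; rewrite linear_comb.
have [g0 hg0] := choice mk.
have [|g hg] := @mk_linear R V (HomMod U C) g0.
  by move=> r v w; apply: hom_ext => u; rewrite hom_funP !hg0 hom_comb.
exists g; last by move=> u v; rewrite hg hg0.
apply: linear_bijective => [v gv|h].
  apply: (can_inj f1); rewrite linear0; apply: hom_ext => h.
  by rewrite hf -[h]b2 -hg0 -hg gv.
have [|xi hxi] := @mk_hom R (HomMod V C) C (fun k => hom_fun h (b' k)).
  move=> r k l; rewrite -hom_comb; congr (hom_fun h _).
  by apply: (can_inj b1); rewrite linear_comb !b2.
exists (f' xi); apply: hom_ext => u.
by rewrite hg hg0 -hf f2 hxi b1.
Qed.

End Pairing.

(** * The two implications *)

Section MainTheorem.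
Variables (R : comNzRingType) (m : ideal R) (K M : lmodType R) (I : ideal R).
Local Notation A := (idealization M).
Local Notation sc := (@idl_scal R M).
Local Notation ve := (@idl_vec R M).
Variable x : R.
Hypotheses (Hx : local_param m x) (HK : dualizing m x K).
Hypotheses (Mfg : fin_gen M) (Mreg : regular M x).
Hypotheses (dim_R : krull_dim R 1) (K_canonical : canonical_module m K).

Let Kfg : fin_gen K. Proof. by case: HK. Qed.
Let Kreg : regular K x. Proof. by case: HK. Qed.

Lemma regular_pow (V : lmodType R) k (v : V) : regular V x -> x ^+ k *: v = 0 -> v = 0.
Proof.
move=> Vreg; elim: k => [|k IH]; first by rewrite expr0 scale1r.
by rewrite exprS -scalerA => /Vreg /IH.
Qed.

Lemma coind_canonical_module (n : ideal A) : (forall z : A, (z \in n) = (z.1 \in m)) ->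
  canonical_module n (coind M K).
Proof.
move=> hn; apply: (coind_canonical Hx Mfg Mreg hn HK dim_R).
by case: K_canonical.
Qed.

Lemma idl_maximal : exists n : ideal A, forall z : A, (z \in n) = (z.1 \in m).
Proof.
have [|n hn] := @sub_closed A (A^o : lmodType A) (fun z : A => z.1 \in m).
  have [h0 hS] := is_sub_closed m.
  by split=> // r u v hu hv; apply: (hS r.1).
by exists n => z; apply/idP/idP => /hn.
Qed.

Lemma canonical_reduction_of_dual : lmod_iso M (HomMod (submod I) K) ->
  reduction I m -> exists (L : submodClosed M) (J : ideal A),
    (forall z : A, (z \in J) = (z.1 \in I) && (z.2 \in L)) /\ canonical_reduction J.
Proof.
move=> [al alb] hred; have [al' al1 al2] := alb.
have [n hn] := idl_maximal.
have [k xkI] := reduction_pow hred (param_mem Hx).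
(* A power of [x] lies in [I] and is regular on K, so an element of K is determined by its
   multiplication map on [I]. *)
have KI (c : K) : (forall a : R, a \in I -> a *: c = 0) -> c = 0.
  by move=> /(_ _ xkI) /(regular_pow Kreg).
pose LP (p : M) := exists c : K, forall a :
  submod I, hom_fun (al p) a = (submod_val a : R) *: c.
have hLP : is_sub LP.
  split; first by exists 0 => a; rewrite linear0 scaler0.
  move=> r p q [c hc] [d hd]; exists (r *: c + d) => a.
  by rewrite linear_comb hom_funP hc hd; lmod.
have [L hL] := sub_closed hLP.
(* For a in I, a times the homomorphism [al p] is multiplication by the constant [al p] at a. Thus I
   M lies in L, which makes I x L an ideal. *)
have IM (a : R) p : a \in I -> LP (a *: p).
  move=> ha; exists (hom_fun (al p) (Submod ha)) => b.
  rewrite linearZ_LR hom_funZ -!homZ; congr (hom_fun _ _).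
  by apply: val_inj; apply: mulrC.
have [|J hJ0] := @sub_closed A (A^o : lmodType A) (fun z : A => z.1 \in I /\ z.2 \in L).
  split; first by split; apply: rpred0.
  move=> r u v [hu1 hu2] [hv1 hv2]; split.
    by apply: (is_sub_closed I).2.
  apply: (is_subD (is_sub_closed L)) => //.
  apply: (is_subD (is_sub_closed L)); first exact: is_subZ (is_sub_closed L) _.
  by apply/hL/IM.
have hJ (z : A) : (z \in J) = (z.1 \in I) && (z.2 \in L).
  by apply/idP/andP => /hJ0.
exists L, J; split=> //; exists n; split.
- exact: (idl_local_ring Hx hn).
- exists (coind M K); split; first exact: coind_canonical_module.
  have decK p : exists c : K, p \in L -> forall a : submod I,
      hom_fun (al p) a = (submod_val a : R) *: c.
    by have [/hL [c hc]|np] := pselect (is_true (p \in L)); [exists c|exists 0].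
  have [kk hkk] := choice decK.
  have kkE p c : p \in L -> (forall a :
    submod I, hom_fun (al p) a = (submod_val a : R) *: c) -> kk p = c.
    move=> hp hc; apply/subr0_eq/KI => a ha.
    by rewrite scalerBr -(hkk p hp (Submod ha)) -(hc (Submod ha)) subrr.
  have uI (u : submod J) : (submod_val u).1 \in I.
    by have := submod_valP u; rewrite hJ => /andP [].
  have uL (u : submod J) : (submod_val u).2 \in L.
    by have := submod_valP u; rewrite hJ => /andP [].
  pose e u : submod I := Submod (uI u).
  have mkh (a : submod I) : exists h :
    HomMod M K, forall p, hom_fun h p = hom_fun (al p) a.
    have [|h hh] := @mk_hom R M K (fun p => hom_fun (al p) a);
      last by exists h => p; rewrite hh.
    by move=> r p q; rewrite linear_comb.
  have [h0 hh0] := choice mkh.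
  (* A pair (a, p) goes to the element of K by which p multiplies, and to evaluation at a on M =
     Hom(I, K). *)
  have [|Psi hPsi] := @mk_linear A (submod J) (coind M K) (fun u =>
    (kk (submod_val u).2, h0 (e u))).
    move=> z u v; rewrite coindE coind_addE; congr pair.
      apply: kkE; first exact: uL.
      move=> a; rewrite -[(submod_val (z *: u + v)).2]/(z.1 *:
        (submod_val u).2 + (submod_val u).1 *: z.2 + (submod_val v).2).
      rewrite linearD linear_comb linearZ_LR hom_funD hom_funP hom_funZ.
      rewrite (hkk _ (uL u)) (hkk _ (uL v)) hh0.
      rewrite -homZ.
      have -> : (submod_val u).1 *: a = (submod_val a : R) *: e u.
        by apply: val_inj; apply: mulrC.
      by rewrite homZ; lmod.
    apply: hom_ext => p; rewrite hom_funP !hh0 -hom_comb; congr (hom_fun _ _).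
    exact: val_inj.
  exists Psi.
  have Ifg : fin_gen (submod I).
    by apply/fg_submod; apply: (param_noeth Hx); apply: is_sub_closed.
  have Ireg : regular (submod I) x.
    by move=> a xa; apply: val_inj; apply: (param_reg Hx);
      have := congr1 (@submod_val _ _ _) xa.
  have [f [f' f1 f2] hf] := reflexive Hx HK Ifg Ireg.
  apply: linear_bijective => [u|[c h]].
    rewrite hPsi => hu; have /= u2 := congr1 (@fst _ _) hu;
      have /= u1 := congr1 (@snd _ _) hu.
    have e0 : e u = 0.
      apply: (can_inj f1); rewrite linear0; apply: hom_ext => h.
      by rewrite hf -[h]al2 -hh0 u1.
    have p0 : (submod_val u).2 = 0.
      apply: (can_inj al1); rewrite linear0; apply: hom_ext => a.
      by rewrite (hkk _ (uL u)) u2 scaler0.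
    apply: val_inj; rewrite /= [submod_val u]surjective_pairing p0.
    by have := congr1 (@submod_val _ _ _) e0 => /= ->.
  (* The preimage of (c, h): multiplication by c gives the component in L, and reflexivity of [I]
     turns h into an element of [I]. *)
  have [|g hg] := @mk_hom R (submod I) K (fun a => (submod_val a : R) *: c).
    by move=> r a b; rewrite scalerA -scalerDl.
  have pL : al' g \in L by apply/hL; exists c => a; rewrite al2 hg.
  have [|xi hxi] := @mk_hom R (HomMod (submod I) K) K (fun k => hom_fun h (al' k)).
    move=> r k1 k2; rewrite -hom_comb; congr (hom_fun h _).
    by apply: (can_inj al1); rewrite linear_comb !al2.
  have hz : ((submod_val (f' xi), al' g) : A) \in J by rewrite hJ; apply/andP;
    split; first exact: submod_valP.
  exists (Submod hz); rewrite hPsi /=; congr pair.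
    by apply: kkE => // a; rewrite al2 hg.
  apply: hom_ext => p; rewrite hh0.
  have -> : e (Submod hz) = f' xi by apply: val_inj.
  by rewrite -hf f2 hxi al1.
- exact: (reduction_lift hn hJ hred).
Qed.

(* K is indecomposable: an idempotent endomorphism is scalar modulo x, hence
   congruent to 0 or to 1. *)
Lemma idempotent_trivial (pi : {linear K -> K}) : (forall c, pi (pi c) = pi c) ->
  (forall c, pi c = 0) \/ (forall c, pi c = c).
Proof.
move=> idem; have hxK := is_sub_mulx (V := K) x.
have [|r hr] := endo_scalar Hx HK (f := pi).
  by move=> r u v _ _; rewrite linear_comb subrr; case: hxK.
(* Idempotence makes r (1 - r) kill K/xK, and in a local ring r or 1 - r is a unit. *)
have r2 (c : K) : mulx x ((r * (1 - r)) *: c).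
  have h1 := hr c; have h2 := hr (pi c); rewrite idem in h2.
  have := is_subD hxK (is_subB hxK h1 h2) (is_subZ (- r) hxK h1).
  by move=> h3; have := is_subN hxK h3; congr mulx; lmod.
have [rm|rm] := boolP (r \in m).
  left => c; have [b hb] := param_unit1 Hx rm.
  have small (d : K) : mulx x (pi d).
    apply: (is_subBl hxK _ (hr d)); have := is_subZ b hxK (r2 d).
    rewrite scalerA; have -> : b * (r * (1 - r)) = r * (b * (1 - r)) by ring.
    by rewrite hb mulr1.
  apply: (nakayama_full Hx Kfg (U := fun c => pi c = 0) (ker_sub pi)) => d.
  have [k hk] := small d; exists (d - pi d), k; split; last by rewrite -hk subrK.
  by rewrite linearB /= idem subrr.
right=> c; have himg : is_sub (fun c => pi c = c).
  split; first exact: linear0.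
  by move=> a u v hu hv; rewrite linear_comb hu hv.
apply: (nakayama_full Hx Kfg himg) => d.
have h1 : mulx x ((1 - r) *: d).
  by apply: (unit_cancel Hx hxK rm); rewrite scalerA.
have [k hk] : mulx x (d - pi d).
  by have := is_subB hxK h1 (hr d); congr mulx; lmod.
by exists (pi d), k; split; [apply: idem|rewrite -hk addrC subrK].
Qed.

Lemma dual_of_canonical_reduction (L : submodClosed M) (J : ideal A) :
  (exists y : M, y <> 0) ->
  (forall z : A, (z \in J) = (z.1 \in I) && (z.2 \in L)) -> canonical_reduction J ->
  lmod_iso M (HomMod (submod I) K) /\ reduction I m.
Proof.
move=> [y0 ny0] hJ [n [n_local [K' [K'can K'iso]] J_red]].
have hn (z : A) : (z \in n) = (z.1 \in m).
  have [n0 hn0] := idl_maximal; rewrite -hn0.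
  by apply: (idl_local_ring Hx hn0).2; case: n_local.
have I_red : reduction I m := (reduction_descend hn hJ J_red).
split=> //; have HA := idl_local_param Hx Mfg Mreg hn.
have dim_A := idl_krull_dim M dim_R.
have HK' := canonical_dualizing HA dim_A K'can.
have HcK := canonical_dualizing HA dim_A (coind_canonical_module hn).
have [Th [Th' Th1 Th2]] := lmod_iso_trans K'iso (dualizing_unique HA HK' HcK).
(* [th] is [Th] as a function on all of A, arbitrary outside [J], so that membership proofs stay out
   of the terms. *)
have mkth (z : A) : exists v : coind M K, forall hz : z \in J, v = Th (Submod hz).
  have [hz|nz] := pselect (is_true (z \in J)); last by exists 0.
  by exists (Th (Submod hz)) => hz'; congr (Th _); apply: val_inj.
have [th hth] := choice mkth.
have J_sub := is_sub_closed J.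
have Jmul (z w : A) : w \in J -> z * w \in J by apply: (is_subZ z J_sub).
have thZ (z w : A) : w \in J -> th (z * w) = z *: th w.
  move=> hw; rewrite (hth _ hw) (hth _ (Jmul z w hw)) -linearZ_LR.
  by congr (Th _); apply: val_inj.
have thD (z w : A) : z \in J -> w \in J -> th (z + w) = th z + th w.
  move=> hz hw; rewrite (hth _ hz) (hth _ hw) (hth _ (is_subD J_sub hz hw)) -linearD.
  by congr (Th _); apply: val_inj.
have thinj (z w : A) : z \in J -> w \in J -> th z = th w -> z = w.
  move=> hz hw; rewrite (hth _ hz) (hth _ hw) => /(can_inj Th1) e.
  by have := congr1 (@submod_val _ _ _) e.
have J0 : 0 \in J by case: J_sub.
have th0 : th 0 = 0.
  by rewrite -(mulr0 (0 : A)) thZ // scale0r.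
have thsurj v : exists2 z, z \in J & th z = v.
  exists (submod_val (Th' v)); first exact: submod_valP.
  by rewrite (hth _ (submod_valP (Th' v))) -[RHS]Th2; congr (Th _); apply: val_inj.
have scJ a : a \in I -> sc a \in J by apply: scal_mem.
have veJ p : p \in L -> ve p \in J by move=> hp; rewrite hJ; apply/andP; split;
  first exact: rpred0.
have zI (z : A) : z \in J -> z.1 \in I by rewrite hJ => /andP [].
have zL (z : A) : z \in J -> z.2 \in L by rewrite hJ => /andP [].
have veZ p (u : coind M K) : ve p *: u = (hom_fun u.2 p, 0).
  by case: u => e h; rewrite coindE /= !scale0r add0r.
(* 0 x M annihilates 0 x L, and the elements of [coind M K] annihilated by 0 x M are exactly those
   of K. *)
have th_ve p : ve p \in J -> (th (ve p)).2 = 0.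
  move=> hp; apply: hom_ext => q.
  have := thZ (ve q) _ hp; rewrite idl_vec_vec th0 veZ => e.
  by have := congr1 (@fst _ _) e.
have th_split (z : A) : z \in J -> th z = th (sc z.1) + th (ve z.2).
  by move=> hz; rewrite -thD; [rewrite -idl_split|apply/scJ/zI|apply/veJ/zL].
have th_split2 (z : A) : z \in J -> (th z).2 = (th (sc z.1)).2.
  by move=> hz; rewrite th_split // -[LHS]/(_ + (th (ve z.2)).2) th_ve ?addr0
    //; apply/veJ/zL.
have mulve (a : R) p : ve p * sc a = ve (a *: p) by rewrite mulrC idl_scal_vec.
(* the projection of K along the part of K carried by L *)
have decz c : exists2 z, z \in J & th z = ((c, 0) : coind M K) by apply: thsurj.
have [pr0 hpr0] := choice (fun c => let: ex_intro2 z h1 h2 :=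
  decz c in ex_intro (fun z => z \in J /\ th z = (c, 0)) z (conj h1 h2)).
(* Dropping the L-part of the preimage changes only the K-component, so its I-part alone is also
   mapped into K; the value is [pi c]. *)
have th_pr c : th (sc (pr0 c).1) = ((th (sc (pr0 c).1)).1, 0).
  have [h1 h2] := hpr0 c; rewrite [LHS]surjective_pairing -th_split2 //.
  by rewrite h2.
have prP (c : K) z : z \in J -> th z = (c, 0) -> pr0 c = z.
  by move=> hz e; have [h1 h2] := hpr0 c; apply: thinj => //; rewrite h2.
have [|pi hpi] := @mk_linear R K K (fun c => (th (sc (pr0 c).1)).1).
  move=> r c d; have [c1 c2] := hpr0 c; have [d1 d2] := hpr0 d.
  have h1 : sc r * pr0 c + pr0 d \in J by apply: (is_subD J_sub) => //; apply: Jmul.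
  rewrite (prP _ _ h1); last first.
    rewrite thD ?thZ // ?c2 ?d2; last exact: Jmul.
    by rewrite coindE coind_addE; congr pair;
      [rewrite hom0 addr0|rewrite scaler0 addr0].
  rewrite -[(sc r * _ + _).1]/(r * (pr0 c).1 + (pr0 d).1) idl_scalD idl_scalM
    thD ?thZ //.
  - by rewrite th_pr coindE -[LHS]/(_ + (th (sc (pr0 d).1)).1) /= addr0.
  - exact/scJ/zI.
  - exact/Jmul/scJ/zI.
  - exact/scJ/zI.
have pi_sc a c : a \in I -> th (sc a) = (c, 0) -> pi c = c.
  by move=> ha e; rewrite hpi (prP c (sc a)) ?scJ // e.
have pi_ve p c : p \in L -> th (ve p) = (c, 0) -> pi c = 0.
  by move=> hp e; rewrite hpi (prP c (ve p)) ?veJ //= [sc 0]/(0 : A) th0.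
have [|pi0|pi1] := @idempotent_trivial pi.
- move=> c; have [h1 h2] := hpr0 c.
  by apply: (pi_sc (pr0 c).1); [apply: zI|rewrite hpi; apply: th_pr].
(* Elements of [I] mapped into K give fixed points of [pi]. With [pi] zero, the map from [I] to
   Hom(M, K) is injective, and it is onto since [th] is onto and the L-part contributes nothing
   there. *)
- have inj0 a : a \in I -> (th (sc a)).2 = 0 -> a = 0.
    move=> ha h2; have e :
      th (sc a) = ((th (sc a)).1, 0) by rewrite -h2 -surjective_pairing.
    have c0 := pi_sc _ _ ha e; rewrite pi0 in c0.
    have : sc a = 0 by apply: thinj => //; [apply: scJ|rewrite e -c0 th0].
    by case.
  have [|be hbe] := @mk_linear R (submod I) (HomMod M K) (fun a =>
    (th (sc (submod_val a))).2).
    move=> r a b; have ha := submod_valP a; have hb := submod_valP b.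
    rewrite -[submod_val (r *: a + b)]/(r * (submod_val a) + submod_val b).
    have hsa := scJ _ ha; have hsb := scJ _ hb.
    by rewrite idl_scalD idl_scalM thD ?thZ //; apply: Jmul.
  have beb : bijective be.
    apply: linear_bijective => [a|h].
      by rewrite hbe => /inj0 h; apply: val_inj; apply: h; apply: submod_valP.
    have [z hz ez] := thsurj ((0, h) : coind M K).
    by exists (Submod (zI z hz)); rewrite hbe /= -th_split2 // ez.
  have [g gb _] := dual_swap Hx HK Mfg Mreg beb.
  by exists g.
exfalso; apply: ny0.
have L0 p : p \in L -> p = 0.
  move=> hp; have e : th (ve p) = ((th (ve p)).1, 0).
    by rewrite -(th_ve p) ?veJ // -surjective_pairing.
  have c0 := pi_ve _ _ hp e; rewrite pi1 in c0.
  have : ve p = 0 by apply: thinj => //; [apply: veJ|rewrite e c0 th0].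
  by case.
(* Some power of [x] lies in [I], and its product with [y0] lies in [L], which is zero here;
   regularity on M then gives y0 = 0. *)
have [k xkI] := reduction_pow I_red (param_mem Hx).
apply: (regular_pow (k := k) Mreg); apply: L0.
by have := zL _ (Jmul (ve y0) _ (scJ _ xkI)); rewrite mulve.
Qed.

End MainTheorem.

Theorem mainTheorem5 (R : comNzRingType) (m : ideal R) (K M : lmodType R)
    (I : ideal R)
    (R_CM : CM_local_ring m) (dim_R : krull_dim R 1)
    (K_canonical : canonical_module m K) (M_MCM : maximal_CM m M) :
  (exists (L : submodClosed M) (J : ideal (idealization M)),
     (forall z : idealization M, (z \in J) = (z.1 \in I) && (z.2 \in L)) /\
     canonical_reduction J)
  <->
  (lmod_iso M (HomMod (submod I) K) /\ reduction I m).
Proof.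
have [/noetherian_noeth R_noeth R_local [d dim_d depth_R]] := R_CM.
rewrite -(krull_dim_unique dim_R dim_d) in depth_R.
have [x [xm xreg _]] := depth1_regular depth_R.
have Hx : local_param m x by apply: local_paramP => //; case: dim_R.
have HK := canonical_dualizing Hx dim_R K_canonical.
have depth_M := maximal_CM_depth1 dim_R M_MCM.
have Mreg := regular_of_depth1 Hx depth_M.
have Mfg : fin_gen M by case: M_MCM.
have M_neq0 : exists y : M, y <> 0.
  have [z [_ _ [y hy]]] := depth1_regular depth_M; exists y => y0; apply: hy.
  by rewrite y0; exists 0; rewrite scaler0.
split=> [[L [J [hJ J_red]]]|[M_iso I_red]].
  exact: (dual_of_canonical_reduction Hx HK Mfg Mreg dim_R K_canonical M_neq0 hJ J_red).
exact: (canonical_reduction_of_dual Hx HK Mfg Mreg dim_R K_canonical M_iso I_red).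
Qed.
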